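(* Let $\alpha\in(0,1)$, $N\ge 2$ and $0<q<1<p$. Let $u$ be a positive classical solution of $$(-\Delta)^{\alpha}u=u^p-u^q\ \text{ in }\mathbb{R}^N,\qquad u>0\ \text{ in }\mathbb{R}^N,\qquad \lim_{|x|\to\infty}u(x)=0,$$ satisfying $$u(x)=O\left(|x|^{-\frac{N+2\alpha}{q}}\right)\qquad\text{as } |x|\to\infty .$$ Then $u$ is radially symmetric and strictly decreasing about some point, i.e. there is $x_0\in\mathbb{R}^N$ such that $u(x)$ depends only on $|x-x_0|$ and is strictly decreasing in $r=|x-x_0|$ for $r>0$.
   Context: For $\alpha\in(0,1)$ the fractional Laplacian is $$(-\Delta)^\alpha u(x)=P.V.\int_{\mathbb{R}^N}\frac{u(x)-u(y)}{|x-y|^{N+2\alpha}}\,dy,$$ where $P.V.$ denotes the principal value at $y=x$. A classical solution is a continuous function $u:\mathbb{R}^N\to\mathbb{R}$ such that $(-\Delta)^\alpha u(x)$ is defined by this formula at every $x\in\mathbb{R}^N$ and the equation holds pointwise. *)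

(* Defs.v *)
From HB Require Import structures.
From mathcomp Require Import all_boot all_order all_algebra.
From mathcomp Require Import all_classical all_reals all_analysis.

Set Implicit Arguments.
Unset Strict Implicit.
Unset Printing Implicit Defensive.

Import Order.TTheory GRing.Theory Num.Theory.
Import numFieldNormedType.Exports.

Local Open Scope classical_set_scope.
Local Open Scope ring_scope.

(* R^n is 'rV[R]_n with the product topology of the library. The library norm
   `|x| on 'rV[R]_n is the sup norm, hence the Euclidean norm below. *)
Definition enorm (R : realType) (n : nat) (x : 'rV[R]_n) : R :=
  Num.sqrt (\sum_(i < n) x 0 i ^+ 2).

Definition rV_display : measure_display. Proof. exact. Qed.

(* The product (= Borel) sigma-algebra on R^n, generated by the coordinates. *)
Section measurable_rV.
Variables (R : realType) (n : nat).

Let coors : 'I_n -> 'rV[R]_n -> R := fun i x => x 0 i.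

Let rV_set0 : g_sigma_preimage coors set0.
Proof. exact: sigma_algebra0. Qed.

Let rV_setC A : g_sigma_preimage coors A -> g_sigma_preimage coors (~` A).
Proof. exact: sigma_algebraC. Qed.

Let rV_bigcup (F : _^nat) : (forall i, g_sigma_preimage coors (F i)) ->
  g_sigma_preimage coors (\bigcup_i (F i)).
Proof. exact: sigma_algebra_bigcup. Qed.

HB.instance Definition _ := @isMeasurable.Build rV_display
  'rV[R]_n (g_sigma_preimage coors) rV_set0 rV_setC rV_bigcup.

End measurable_rV.

Lemma measurable_coord (R : realType) n (i : 'I_n) :
  measurable_fun [set: 'rV[R]_n] (fun x => x 0 i).
Proof.
move=> _ Y mY; rewrite setTI; apply: sub_sigma_algebra => /=.
rewrite -bigcup_seq/=; exists i => /=; first by rewrite mem_index_enum.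
by exists Y => //; rewrite setTI.
Qed.

Lemma measurable_fun_coordP (R : realType) n d (T : measurableType d)
    (f : T -> 'rV[R]_n) :
  (forall i, measurable_fun [set: T] (fun t => f t 0 i)) ->
  measurable_fun [set: T] f.
Proof.
move=> mf _ A mA; rewrite setTI.
suff : g_sigma_preimage (fun i : 'I_n => fun x : 'rV[R]_n =>
    x 0 i) `<=` [set B | measurable (f @^-1` B)] by apply.
apply: smallest_sub => [|B].
  split => /=; first by rewrite preimage_set0.
  - by move=> B mB; rewrite setTD -preimage_setC; exact: measurableC.
  - move=> F mF; rewrite preimage_bigcup; exact: bigcup_measurable.
rewrite -bigcup_seq => -[i /= _ [Y mY <-]].
by rewrite setTI -[X in measurable X]setTI; exact: mf.
Qed.

Definition cons_rV (R : realType) n (z : measurableTypeR R * 'rV[R]_n) :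
  'rV[R]_n.+1 := row_mx (const_mx z.1 : 'rV[R]_1) z.2.

Lemma cons_rV0 (R : realType) n (z : measurableTypeR R * 'rV[R]_n) :
  cons_rV z 0 ord0 = z.1.
Proof.
have -> : @ord0 n = lshift n (@ord0 0) by exact/val_inj.
by rewrite [LHS](row_mxEl (const_mx z.1 : 'rV[R]_1)) mxE.
Qed.

Lemma cons_rVS (R : realType) n (z : measurableTypeR R * 'rV[R]_n) (i : 'I_n) :
  cons_rV z 0 (lift ord0 i) = z.2 0 i.
Proof.
have -> : lift ord0 i = rshift 1 i by exact/val_inj.
by rewrite [LHS](row_mxEr (const_mx z.1 : 'rV[R]_1)).
Qed.

Lemma measurable_cons_rV (R : realType) n :
  measurable_fun setT (@cons_rV R n).
Proof.
apply: measurable_fun_coordP => i.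
case: (unliftP ord0 i) => [j|] ->.
  under eq_fun do rewrite cons_rVS.
  exact: (measurableT_comp (@measurable_coord R n j) measurable_snd).
by under eq_fun do rewrite cons_rV0; exact: measurable_fst.
Qed.

Lemma measurable_cons_rV_preimage (R : realType) n (A : set 'rV[R]_n.+1) :
  measurable A -> measurable (@cons_rV R n @^-1` A).
Proof.
by move=> mA; rewrite -[X in measurable X]setTI; exact: measurable_cons_rV.
Qed.

Section lebesgue_cons.
Variables (R : realType) (n : nat).
Variable m : {sigma_finite_measure set 'rV[R]_n -> \bar R}.

Definition lebesgue_cons : set 'rV[R]_n.+1 -> \bar R :=
  pushforward (@lebesgue_measure R \x m)%E (@cons_rV R n).

Let lebesgue_cons0 : lebesgue_cons set0 = 0%E.
Proof. by rewrite /lebesgue_cons /pushforward preimage_set0 measure0. Qed.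

Let lebesgue_cons_ge0 A : (0 <= lebesgue_cons A)%E.
Proof. by rewrite /lebesgue_cons /pushforward measure_ge0. Qed.

Let lebesgue_cons_sigma_additive : semi_sigma_additive lebesgue_cons.
Proof.
move=> F mF tF mUF; rewrite /lebesgue_cons /pushforward preimage_bigcup.
apply: measure_semi_sigma_additive.
- by move=> k; exact: measurable_cons_rV_preimage.
- apply/trivIsetP => i j _ _ ij; rewrite -preimage_setI.
  by move/trivIsetP : tF => /(_ _ _ _ _ ij) ->//; rewrite preimage_set0.
- by rewrite -preimage_bigcup; exact: measurable_cons_rV_preimage.
Qed.

HB.instance Definition _ := isMeasure.Build _ _ _ lebesgue_cons
  lebesgue_cons0 lebesgue_cons_ge0 lebesgue_cons_sigma_additive.

Let lebesgue_cons_sigma_finite : sigma_finite setT lebesgue_cons.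
Proof.
have /sigma_finiteP[F [TF ndF Foo]] := sigma_finiteT (@lebesgue_measure R).
have /sigma_finiteP[G [TG ndG Goo]] := sigma_finiteT m.
pose hd (x : 'rV[R]_n.+1) : R := x 0 ord0.
pose tl (x : 'rV[R]_n.+1) : 'rV[R]_n := \row_j x 0 (lift ord0 j).
have mtl : measurable_fun setT tl.
  apply: measurable_fun_coordP => i.
  by under eq_fun do rewrite mxE; exact: measurable_coord.
exists (fun k => hd @^-1` F k `&` tl @^-1` G k).
  apply/esym/seteqP; split => // x _.
  have [i _ Fi] : (\bigcup_i F i) (hd x) by rewrite -TF.
  have [j _ Gj] : (\bigcup_i G i) (tl x) by rewrite -TG.
  exists (maxn i j) => //; split.
  - by rewrite /preimage/=; move: (hd x) Fi; exact/subsetPset/ndF/leq_maxl.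
  - by rewrite /preimage/=; move: (tl x) Gj; exact/subsetPset/ndG/leq_maxr.
move=> k; have [mF Fk] := Foo k; have [mG Gk] := Goo k; split.
  apply: measurableI.
    by rewrite -[X in measurable X]setTI; exact: measurable_coord.
  by rewrite -[X in measurable X]setTI; exact: mtl.
rewrite /lebesgue_cons /pushforward.
have -> : @cons_rV R n @^-1`
    (hd @^-1` F k `&` tl @^-1` G k) = F k `*` G k.
  apply/seteqP; split => -[a v] /=; rewrite /hd cons_rV0 /tl.
  - move=> [Fa]; rewrite (_ : \row_j _ = v)//.
    by apply/rowP => j; rewrite mxE cons_rVS.
  - move=> [Fa Gv]; split => //; rewrite (_ : \row_j _ = v)//.
    by apply/rowP => j; rewrite mxE cons_rVS.
by rewrite product_measure1E// lte_mul_pinfty// ge0_fin_numE.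
Qed.

HB.instance Definition _ := Measure_isSigmaFinite.Build _ _ _
  lebesgue_cons lebesgue_cons_sigma_finite.

End lebesgue_cons.

(* Lebesgue measure on R^n, the n-fold product of Lebesgue measure on R. *)
Fixpoint lebesgue_rV (R : realType) (n : nat) :
    {sigma_finite_measure set 'rV[R]_n -> \bar R} :=
  match n with
  | 0 => \d_(0 : 'rV[R]_0)
  | k.+1 => lebesgue_cons (lebesgue_rV R k)
  end.

Lemma lebesgue_rV_box (R : realType) n (A : 'I_n -> set (measurableTypeR R)) :
  (forall i, measurable (A i)) ->
  lebesgue_rV R n [set x | forall i, A i (x 0 i)] =
  (\prod_(i < n) lebesgue_measure (A i))%E.
Proof.
elim: n A => [|n ih] A mA.
  rewrite big_ord0 /= diracE mem_set//; by case.
rewrite big_ord_recl -ih//= /lebesgue_cons /pushforward.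
have -> : @cons_rV R n @^-1` [set x | forall i, A i (x 0 i)] =
    A ord0 `*` [set x : 'rV[R]_n | forall i, A (lift ord0 i) (x 0 i)].
  apply/seteqP; split => z /=.
    move=> Az; split; first by rewrite -cons_rV0; exact: Az.
    by move=> i; rewrite -cons_rVS; exact: Az.
  move=> [Az0 AzS] i; case: (unliftP ord0 i) => [j|] ->.
    by rewrite cons_rVS.
  by rewrite cons_rV0.
apply: product_measure1E => //.
rewrite (_ : [set x | _] = \bigcap_(i in [set: 'I_n])
    ((fun x : 'rV[R]_n => x 0 i : measurableTypeR R) @^-1` A (lift ord0 i))).
  apply: fin_bigcap_measurable => // i _; rewrite -[X in measurable X]setTI.
  by apply: measurable_coord => //; exact: mA.
by apply/seteqP; split => x /= Ax i; [move=> _|]; exact: Ax.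
Qed.

(* Neighbourhoods of infinity in R^n; enorm and the library norm are equivalent,
   so the choice of norm does not matter here. *)
Definition at_infinity (R : realType) (n : nat) : set_system 'rV[R]_n :=
  filter_from [set: R] (fun M => [set x | M < enorm x]).
Arguments at_infinity {R n}.

Global Instance at_infinity_filter (R : realType) (n : nat) :
  Filter (@at_infinity R n).
Proof.
apply: filter_from_filter; first by exists 0.
move=> M1 M2 _ _; exists (Num.max M1 M2) => // x /=.
by rewrite gt_max => /andP[].
Qed.

Canonical at_infinity_filter_on (R : realType) (n : nat) :=
  FilterType (at_infinity : set_system 'rV[R]_n) (at_infinity_filter R n).

Section fractional_laplacian.
Variables (R : realType) (N : nat) (alpha : R) (u : 'rV[R]_N -> R).

Definition frac_kernel (x y : 'rV[R]_N) : R :=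
  (u x - u y) / enorm (x - y) `^ (N%:R + 2 * alpha).

(* The integral over |x - y| > e, whose limit as e -> 0+ is the principal
   value at y = x. *)
Definition frac_truncated (x : 'rV[R]_N) (e : R) : R :=
  Rintegral (lebesgue_rV R N) [set y | e < enorm (x - y)] (frac_kernel x).

(* Rintegral and lim are total: the principal value is meaningful only when the
   truncated integrals converge absolutely and have a finite limit. *)
Definition frac_laplacian_defined (x : 'rV[R]_N) : Prop :=
  (forall e : R, 0 < e -> (lebesgue_rV R N).-integrable
     [set y | e < enorm (x - y)] (EFin \o frac_kernel x)) /\
  cvg (frac_truncated x e @[e --> 0^'+]).

Definition frac_laplacian (x : 'rV[R]_N) : R :=
  lim (frac_truncated x e @[e --> 0^'+]).

End fractional_laplacian.

Definition classical_solution (R : realType) (N : nat) (alpha : R)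
    (f : R -> R) (u : 'rV[R]_N -> R) : Prop :=
  [/\ continuous u,
      forall x, frac_laplacian_defined alpha u x &
      forall x, frac_laplacian alpha u x = f (u x)].

Definition radially_decreasing_about (R : realType) (N : nat)
    (u : 'rV[R]_N -> R) (x0 : 'rV[R]_N) : Prop :=
  exists phi : R -> R,
    (forall x, u x = phi (enorm (x - x0))) /\
    (forall r s, 0 < r -> r < s -> phi s < phi r).

(* Main.v *)
From mathcomp Require Import all_boot all_order all_algebra.
From mathcomp Require Import all_classical all_reals all_analysis.
From mathcomp Require Import measurable_realfun ring lra.
Require Import Defs.

(** The proof is by moving planes. For a unit vector [e] and a level [l], let
    [w(y) = u(y') - u(y)], where [y'] is the mirror image of [y] in the
    hyperplane [{y . e = l}]. This function changes sign under the mirror, and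
    its fractional Laplacian at [x] is [f(u(x')) - f(u(x))] with
    [f(t) = t^p - t^q], because Lebesgue measure is invariant under the mirror.

    Everything rests on one inequality for such antisymmetric functions
    ([antisymmetric_maximum_principle]). Suppose that [w] has a nonpositive
    minimum over the half-space [{y . e < l}] at [x]. Pairing each [y] with [y']
    in the integral that defines the fractional Laplacian turns the integrand
    into [- (w(y) - w(x)) (K(x - y) - K(x - y')) + 2 w(x) K(x - y')], where [K]
    is the singular kernel; both terms are nonpositive because [x] is closer to
    [y] than to [y']. Integrating this over a suitable cube only has two
    consequences:
    - [narrow_region_estimate]: the fractional Laplacian at [x] is at most
      [C w(x) / d^(2 alpha)] for some [C > 0], where [d] is the
      distance from [x] to the hyperplane;
    - [strong_maximum_principle]: if [w(x) = 0] and the fractional Laplacian is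
      nonnegative at [x], then [w] vanishes on the half-space.

    The function [f] is nonincreasing near 0 and one-sided Lipschitz on bounded
    intervals. At a negative minimum, [u(x') < u(x)], so the first property
    contradicts the negativity of the fractional Laplacian when [u(x)] is small,
    that is when [x] is far away; the second contradicts the narrow region
    estimate when [d] is small. Hence all negative minima lie in one ball, at a
    distance from the hyperplane that is bounded below
    ([negative_minimum_location]). In particular [w >= 0] when [l] is close to
    minus infinity. Let [l] increase to the last level up to which this
    persists; it is finite since [u] is positive and tends to 0. There either
    [w] vanishes, or [w > 0] on the half-space; in the second case [w] stays
    positive on the compact set that could contain negative minima when [l]
    increases a little, a contradiction. So [u] is symmetric about the last
    hyperplane, and increases towards it ([moving_planes]).

    Finally, the hyperplanes orthogonal to the coordinate axes meet at a point
    [x0], about which [u] is centrally symmetric. A symmetry hyperplane that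
    misses [x0] would come with its image through [x0], and the two mirrors
    compose to a translation; but [u] is not periodic. So every direction has
    its symmetry hyperplane through [x0], and [u] is radial. *)

Set Implicit Arguments.
Unset Strict Implicit.
Unset Printing Implicit Defensive.

Import Order.TTheory GRing.Theory Num.Theory.
Import numFieldNormedType.Exports.

Local Open Scope classical_set_scope.
Local Open Scope ring_scope.

(** * Euclidean geometry and reflections in hyperplanes *)

Section euclidean.
Variables (R : realType) (N : nat).
Implicit Types (x y z e : 'rV[R]_N) (a l m : R).

Definition dotv x y : R := \sum_(i < N) x 0 i * y 0 i.

Lemma dotvC x y : dotv x y = dotv y x.
Proof. by apply: eq_bigr => i _; rewrite mulrC. Qed.

Lemma dotvDl x y z : dotv (x + y) z = dotv x z + dotv y z.
Proof. by rewrite -big_split; apply: eq_bigr => i _; rewrite mxE mulrDl. Qed.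

Lemma dotvZl a x y : dotv (a *: x) y = a * dotv x y.
Proof. by rewrite mulr_sumr; apply: eq_bigr => i _; rewrite mxE mulrA. Qed.

Lemma dotvNl x y : dotv (- x) y = - dotv x y.
Proof. by rewrite -scaleN1r dotvZl mulN1r. Qed.

Lemma dotvDr x y z : dotv x (y + z) = dotv x y + dotv x z.
Proof. by rewrite dotvC dotvDl !(dotvC x). Qed.

Lemma dotvZr a x y : dotv x (a *: y) = a * dotv x y.
Proof. by rewrite dotvC dotvZl dotvC. Qed.

Lemma dotvNr x y : dotv x (- y) = - dotv x y.
Proof. by rewrite dotvC dotvNl dotvC. Qed.

Lemma dotv0l x : dotv 0 x = 0.
Proof. by rewrite /dotv big1// => i _; rewrite mxE mul0r. Qed.

Lemma dotv_ge0 x : 0 <= dotv x x.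
Proof. by apply: sumr_ge0 => i _; rewrite -expr2 sqr_ge0. Qed.

Lemma enormE x : enorm x = Num.sqrt (dotv x x).
Proof. by congr Num.sqrt; apply: eq_bigr => i _; rewrite expr2. Qed.

Lemma enorm_ge0 x : 0 <= enorm x.
Proof. exact: sqrtr_ge0. Qed.

Lemma sqr_enorm x : enorm x ^+ 2 = dotv x x.
Proof. by rewrite enormE sqr_sqrtr// dotv_ge0. Qed.

Lemma enormN x : enorm (- x) = enorm x.
Proof. by rewrite !enormE dotvNl dotvNr opprK. Qed.

Lemma enormZ a x : enorm (a *: x) = `|a| * enorm x.
Proof.
by rewrite !enormE dotvZl dotvZr mulrA -expr2 sqrtrM ?sqr_ge0// sqrtr_sqr.
Qed.

Lemma coord_le_norm x i : `|x 0 i| <= `|x|.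
Proof.
rewrite [leRHS]/Num.norm/= mx_normrE.
exact: (le_bigmax _ (fun ij => `|x ij.1 ij.2|) (0, i)).
Qed.

Lemma norm_le_enorm x : `|x| <= enorm x.
Proof.
rewrite [leLHS]/Num.norm/= mx_normrE; apply/bigmax_leP; split => [|[i j] _]/=.
  exact: enorm_ge0.
rewrite ord1 enormE -sqrtr_sqr ler_wsqrtr// /dotv (bigD1 j)//= -expr2 lerDl.
by apply: sumr_ge0 => k _; rewrite -expr2 sqr_ge0.
Qed.

Lemma normr_dotv x y : `|dotv x y| <= N%:R * (`|x| * `|y|).
Proof.
apply: (le_trans (ler_norm_sum _ _ _)).
have -> : N%:R * (`|x| * `|y|) = \sum_(i < N) (`|x| * `|y|).
  by rewrite sumr_const card_ord mulr_natl.
by apply: ler_sum => i _; rewrite normrM ler_pM// coord_le_norm.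
Qed.

Lemma enorm_le_norm x : enorm x <= N%:R * `|x|.
Proof.
rewrite enormE -(ger0_norm (mulr_ge0 (ler0n _ N) (normr_ge0 x))) -sqrtr_sqr.
apply: ler_wsqrtr; apply: (le_trans (ler_norm _)); apply: (le_trans (normr_dotv _ _)).
rewrite exprMn expr2 ler_wpM2r// ?mulr_ge0//.
by case: N => [|n]; rewrite ?mulr0// ler_peMr// ler1n.
Qed.

Lemma enorm_eq0 x : enorm x = 0 -> x = 0.
Proof. by move=> x0; apply/eqP; rewrite -normr_le0 -x0 norm_le_enorm. Qed.

Lemma continuous_sumr (F : 'I_N -> 'rV[R]_N -> R) :
  (forall i, continuous (F i)) -> continuous (fun x => \sum_(i < N) F i x).
Proof.
move=> cF x; rewrite /continuous_at; elim: (index_enum _) => [|i s ih].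
  rewrite (_ : (fun x0 => _) = cst 0); last by apply/funext => y; rewrite big_nil.
  by rewrite big_nil; exact: cst_continuous.
rewrite big_cons (_ : (fun x0 => _) = F i \+ (fun y => \sum_(j <- s) F j y)).
  by apply: continuousD => //; exact: cF.
by apply/funext => y; rewrite big_cons.
Qed.

Lemma continuous_dotv e : continuous (dotv ^~ e).
Proof.
apply: continuous_sumr => i x.
by apply: continuousM; [exact: coord_continuous|exact: cst_continuous].
Qed.

Lemma continuous_enorm : continuous (@enorm R N).
Proof.
move=> x; rewrite /enorm.
apply: (@continuous_comp _ _ _ (fun y : 'rV[R]_N => \sum_(i < N) y 0 i ^+ 2)).
  by apply: continuous_sumr => i {}x; apply: continuousM; exact: coord_continuous.
exact: sqrt_continuous.
Qed.

(** The reflection in the hyperplane [{y . e = l}]; it is one only when [e] is a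
    unit vector. *)
Definition mirror e l x := x + (2 * (l - dotv x e)) *: e.

Section unit_vector.
Variable e : 'rV[R]_N.
Hypothesis e1 : dotv e e = 1.

Lemma enorm_unit : enorm e = 1.
Proof. by rewrite enormE e1 sqrtr1. Qed.

Lemma norm_unit : `|e| <= 1.
Proof. by rewrite -enorm_unit norm_le_enorm. Qed.

Lemma normr_dotv_unit x : `|dotv x e| <= N%:R * `|x|.
Proof.
apply: (le_trans (normr_dotv _ _)); rewrite ler_wpM2l//.
by rewrite ler_piMr// norm_unit.
Qed.

Lemma dotv_mirror l x : dotv (mirror e l x) e = 2 * l - dotv x e.
Proof. by rewrite dotvDl dotvZl e1; ring. Qed.

Lemma mirror_comp l m x : mirror e m (mirror e l x) = x + (2 * (m - l)) *: e.
Proof.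
by rewrite {1}/mirror dotv_mirror /mirror -addrA -scalerDl; congr (_ + _ *: _); ring.
Qed.

Lemma mirrorK l : involutive (mirror e l).
Proof. by move=> x; rewrite mirror_comp subrr mulr0 scale0r addr0. Qed.

Lemma mirror_fixed l x : dotv x e = l -> mirror e l x = x.
Proof. by rewrite /mirror => ->; rewrite subrr mulr0 scale0r addr0. Qed.

Lemma enorm_mirror l x y : enorm (mirror e l x - mirror e l y) = enorm (x - y).
Proof.
have -> : mirror e l x - mirror e l y = (x - y) + (- 2 * dotv (x - y) e) *: e.
  rewrite /mirror opprD addrACA -scaleNr -scalerDl dotvDl dotvNl.
  by congr (_ + _ *: _); ring.
rewrite !enormE; congr Num.sqrt; move: (x - y) => v.
by rewrite dotvDl !dotvDr !dotvZl !dotvZr e1 (dotvC e v); ring.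
Qed.

Lemma enorm_sub_mirror l x y : enorm (x - mirror e l y) = enorm (mirror e l x - y).
Proof. by rewrite -(enorm_mirror l) mirrorK. Qed.

(** The source of every sign in the moving plane argument: on one side of the
    hyperplane, mirroring one of two points moves them apart. *)
Lemma sqr_enorm_sub_mirror l x y : enorm (x - mirror e l y) ^+ 2 =
  enorm (x - y) ^+ 2 + 4 * (l - dotv x e) * (l - dotv y e).
Proof.
have -> : x - mirror e l y = (x - y) + (- (2 * (l - dotv y e))) *: e.
  by rewrite /mirror opprD addrA scaleNr.
have -> : dotv x e = dotv (x - y) e + dotv y e by rewrite dotvDl dotvNl subrK.
rewrite !sqr_enorm; move: (x - y) => v.
by rewrite dotvDl !dotvDr !dotvZl !dotvZr e1 (dotvC e v); ring.
Qed.

Lemma le_enorm_sub_mirror l x y : dotv x e <= l -> dotv y e <= l ->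
  enorm (x - y) <= enorm (x - mirror e l y).
Proof.
move=> xl yl; rewrite -(ler_pXn2r (n := 2))// ?nnegrE ?enorm_ge0//.
by rewrite sqr_enorm_sub_mirror lerDl !mulr_ge0// subr_ge0.
Qed.

Lemma lt_enorm_sub_mirror l x y : dotv x e < l -> dotv y e < l ->
  enorm (x - y) < enorm (x - mirror e l y).
Proof.
move=> xl yl; rewrite -(ltr_pXn2r (n := 2))// ?nnegrE ?enorm_ge0//.
by rewrite sqr_enorm_sub_mirror ltrDl !mulr_gt0// subr_gt0.
Qed.

End unit_vector.
End euclidean.

(** * Invariance of Lebesgue measure under reflections *)

Section lebesgue_rV_invariance.
Variable R : realType.

(** A measure that gives intervals their length is Lebesgue measure, and
    translating an interval does not change its length. *)
Lemma lebesgue_measure_translation (a : R) (A : set (measurableTypeR R)) :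
  measurable A ->
  lebesgue_measure ((fun t : measurableTypeR R => t + a) @^-1` A) =
  lebesgue_measure A.
Proof.
pose f (t : measurableTypeR R) : measurableTypeR R := t + a.
have mf : measurable_fun setT f by apply: measurable_funD.
move=> mA; apply/esym.
apply: (@lebesgue_measure_unique R (pushforward lebesgue_measure f)) => //= _ [[b c]] _ <-.
have -> : pushforward lebesgue_measure f `]b, c] =
    lebesgue_measure (`]b - a, c - a]%classic : set R).
  congr lebesgue_measure; apply/seteqP; split => t /=;
  by rewrite /f !in_itv/= ltrBlDr lerBrDr.
rewrite !lebesgue_measure_itv/= !lte_fin ltrD2r; case: ifP => // _.
by rewrite -!EFinB opprB addrA subrK.
Qed.

Lemma measurable_rV_fun n d (T : measurableType d) (f : T -> 'rV[R]_n)
    (A : set 'rV[R]_n) :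
  (forall i, measurable_fun [set: T] (fun t => f t 0 i)) ->
  measurable A -> measurable (f @^-1` A).
Proof.
by move=> mf mA; rewrite -[X in measurable X]setTI; exact: measurable_fun_coordP.
Qed.

Lemma measurable_fun_addrV n (a : 'rV[R]_n) :
  measurable_fun setT (fun x : 'rV[R]_n => x + a).
Proof.
apply: measurable_fun_coordP => i; under eq_fun do rewrite mxE.
by apply: measurable_funD => //; exact: measurable_coord.
Qed.

(** By induction on the dimension: the translated measure takes the right values
    on products of a set of first coordinates and a set of remaining
    coordinates, and these values determine a product measure. *)
Lemma lebesgue_rV_translation n (a : 'rV[R]_n) (A : set 'rV[R]_n) :
  measurable A -> lebesgue_rV R n ((fun x => x + a) @^-1` A) = lebesgue_rV R n A.
Proof.
elim: n a A => [|n ih] a A mA.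
  congr (lebesgue_rV R 0 _); apply/seteqP; split => x /=;
    by rewrite (thinmx0 (x + a)) (thinmx0 x).
pose v : 'rV[R]_n := \row_i a 0 (lift ord0 i).
pose f (z : measurableTypeR R * 'rV[R]_n) : measurableTypeR R * 'rV[R]_n :=
  (z.1 + a 0 ord0, z.2 + v).
have mf : measurable_fun setT f.
  apply: measurable_fun_pair; last first.
    exact: (measurableT_comp (measurable_fun_addrV v) measurable_snd).
  by apply: measurable_funD => //; exact: measurable_fst.
rewrite /= /lebesgue_cons /pushforward.
have fE z : cons_rV z + a = cons_rV (f z).
  apply/rowP => i; rewrite mxE; case: (unliftP ord0 i) => [j|] ->.
    by rewrite !cons_rVS !mxE.
  by rewrite !cons_rV0.
have -> : @cons_rV R n @^-1` ((fun x => x + a) @^-1` A) =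
    f @^-1` (@cons_rV R n @^-1` A).
  by apply/funext => z; rewrite /preimage/= fE.
apply/esym.
apply: (@product_measure_unique _ _ _ _ _ _ _
  (pushforward (lebesgue_measure \x lebesgue_rV R n)%E f)) => //.
  move=> B C mB mC.
  pose g (t : measurableTypeR R) : measurableTypeR R := t + a 0 ord0.
  pose h (x : 'rV[R]_n) := x + v.
  transitivity (lebesgue_measure (g @^-1` B) * lebesgue_rV R n (h @^-1` C))%E.
    apply: product_measure1E; last first.
      by rewrite -[X in measurable X]setTI; exact: measurable_fun_addrV.
    by rewrite -[X in measurable X]setTI; exact: measurable_funD.
  by congr (_ * _)%E; [exact: lebesgue_measure_translation|exact: ih].
exact: measurable_cons_rV_preimage.
Qed.


Definition cube n (c : 'rV[R]_n) (h : R) : set 'rV[R]_n := [set y | `|y - c| <= h].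

Lemma cubeP n (c y : 'rV[R]_n) h : 0 <= h ->
  cube c h y <-> (forall i, `|y 0 i - c 0 i| <= h).
Proof.
move=> h0; rewrite /cube/=; split => [yc i|yc].
  by apply: le_trans yc; have := coord_le_norm (y - c) i; rewrite !mxE.
rewrite [leLHS]/Num.norm/= mx_normrE; apply/bigmax_leP; split => // -[i j] _ /=.
by rewrite ord1 !mxE.
Qed.

Lemma cube_box n (c : 'rV[R]_n) h : 0 <= h ->
  cube c h = [set y | forall i, `[c 0 i - h, c 0 i + h]%classic (y 0 i)].
Proof.
move=> h0; apply/seteqP; split => y /=.
  by move/(cubeP _ _ h0) => yc i; rewrite in_itv/= -ler_distlC distrC.
by move=> yc; apply/cubeP => // i; have := yc i; rewrite in_itv/= -ler_distlC distrC.
Qed.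

Lemma measurable_cube n (c : 'rV[R]_n) h : 0 <= h -> measurable (cube c h).
Proof.
move=> h0; have -> : cube c h = \bigcap_(i in [set: 'I_n])
    ((fun x : 'rV[R]_n => x 0 i : measurableTypeR R) @^-1` `[c 0 i - h, c 0 i + h]).
  by rewrite cube_box//; apply/seteqP; split => x /= Ax i; [move=> _|]; exact: Ax.
apply: fin_bigcap_measurable => // i _; rewrite -[X in measurable X]setTI.
by apply: measurable_coord => //; exact: measurable_itv.
Qed.

(** The cubes are the balls of the sup norm; they serve as test sets of explicit
    measure throughout. *)
Lemma lebesgue_rV_cube n (c : 'rV[R]_n) h : 0 <= h ->
  lebesgue_rV R n (cube c h) = ((2 * h) ^+ n)%:E.
Proof.
move=> h0; rewrite cube_box//.
rewrite (@lebesgue_rV_box R n (fun i => `[c 0 i - h, c 0 i + h]%classic)); last first.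
  by move=> i; exact: measurable_itv.
rewrite (eq_bigr (fun=> (2 * h)%:E)) => [|i _].
  by rewrite prodEFin prodr_const card_ord.
apply: (etrans (lebesgue_measure_itv `[c 0 i - h, c 0 i + h])); rewrite /= lte_fin.
have -> : (2 * h)%:E = ((c 0 i + h) - (c 0 i - h))%:E by congr (_%:E); ring.
case: ltP => //; rewrite -subr_ge0 => ?; congr (_%:E); lra.
Qed.

Lemma measurable_dotv n (e : 'rV[R]_n) : measurable_fun setT (fun x => dotv x e).
Proof.
rewrite /dotv; apply: measurable_sum => i.
by apply: measurable_funM => //; exact: measurable_coord.
Qed.

Lemma measurable_enorm n : measurable_fun setT (@enorm R n).
Proof.
have -> : @enorm R n = (fun x => (\sum_(i < n) x 0 i ^+ 2) `^ 2^-1).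
  by apply/funext => x; rewrite powR12_sqrt// sumr_ge0// => i _; exact: sqr_ge0.
apply: (measurableT_comp (measurable_powR _)).
apply: measurable_sum => i.
by apply: measurable_funX; exact: measurable_coord.
Qed.

Let unit_ball n : set 'rV[R]_n := [set x | enorm x <= 1].

Let measurable_unit_ball n : measurable (@unit_ball n).
Proof.
rewrite -[X in measurable X]setTI.
apply: (@measurable_fun_ler _ _ _ setT) => //; exact: measurable_enorm.
Qed.

Let unit_ball_fin n : exists2 r : R, 0 < r & lebesgue_rV R n (@unit_ball n) = r%:E.
Proof.
have le1 : (lebesgue_rV R n (@unit_ball n) <= ((2 * 1) ^+ n)%:E)%E.
  rewrite -(@lebesgue_rV_cube _ 0)//; apply: le_measure; rewrite ?inE;
    [exact: measurable_unit_ball|exact: measurable_cube|].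
  by move=> x /=; rewrite /cube/= subr0; exact/le_trans/norm_le_enorm.
(* n.+1 and not n, which may be 0. *)
have le2 : (((2 * n.+1%:R^-1) ^+ n)%:E <= lebesgue_rV R n (@unit_ball n))%E.
  rewrite -(@lebesgue_rV_cube _ 0)//; apply: le_measure; rewrite ?inE;
    [exact: measurable_cube|exact: measurable_unit_ball|].
  move=> x; rewrite /cube/= subr0 => xn; apply: (le_trans (enorm_le_norm x)).
  apply: (le_trans (ler_wpM2l (ler0n _ n) xn)).
  by rewrite ler_pdivrMr ?mul1r ?ler_nat.
have fin : lebesgue_rV R n (@unit_ball n) \is a fin_num.
  by rewrite ge0_fin_numE//; apply: le_lt_trans le1 _; exact: ltry.
exists (fine (lebesgue_rV R n (@unit_ball n))); last by rewrite fineK.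
rewrite -lte_fin fineK//; apply: lt_le_trans le2; rewrite lte_fin.
by rewrite exprn_gt0// mulr_gt0// invr_gt0.
Qed.

Let product_measure1_eq n (E F : set ('rV[R]_n * 'rV[R]_n)) :
  (forall x, lebesgue_rV R n (xsection E x) = lebesgue_rV R n (xsection F x)) ->
  (lebesgue_rV R n \x lebesgue_rV R n)%E E = (lebesgue_rV R n \x lebesgue_rV R n)%E F.
Proof.
by move=> EF; rewrite /product_measure1/=; apply: eq_integral => x _ /=.
Qed.

Let product_measure_swap n (E : set ('rV[R]_n * 'rV[R]_n)) : measurable E ->
  (lebesgue_rV R n \x lebesgue_rV R n)%E E = (lebesgue_rV R n \x^ lebesgue_rV R n)%E E.
Proof.
by apply: product_measure_unique => //= ? ? ? ?; rewrite product_measure2E.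
Qed.

Section isometry.
Variables (n : nat) (H : 'rV[R]_n -> 'rV[R]_n).
Hypotheses (mH : measurable_fun setT H) (HK : involutive H)
  (HD : {morph H : x y / x + y}) (enormH : forall x, enorm (H x) = enorm x).

Let mu := lebesgue_rV R n.

(** The uniqueness argument for Haar measure, in a special case. With [C] the
    unit ball, compute in two ways the measure of the set of the pairs [(x, y)]
    with [x] in [C] and [x + H y] in [B]. Integrating over [y] first gives
    [mu C * mu (H^-1 B)]. Translating the sections in [x] by [- H y] gives the pairs
    with [x] in [B] and [x - H y] in [C], whose measure is [mu B * mu C] because
    [H] preserves [C]. It remains to cancel [mu C]. *)
Lemma lebesgue_rV_isometry (B : set 'rV[R]_n) : measurable B ->
  mu (H @^-1` B) = mu B.
Proof.
move=> mB; pose C := @unit_ball n.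
have mC : measurable C by exact: measurable_unit_ball.
have mHB : measurable (H @^-1` B) by rewrite -[X in measurable X]setTI; exact: mH.
pose E := [set z : 'rV[R]_n * 'rV[R]_n | C z.1 /\ B (z.1 + H z.2)].
pose F := [set z : 'rV[R]_n * 'rV[R]_n | B z.1 /\ C (z.1 - H z.2)].
have mcoord1 i : measurable_fun setT (fun z : 'rV[R]_n * 'rV[R]_n => z.1 0 i).
  exact: (measurableT_comp (measurable_coord i) measurable_fst).
have mcoord2 i : measurable_fun setT (fun z : 'rV[R]_n * 'rV[R]_n => (H z.2) 0 i).
  exact: (measurableT_comp (measurable_coord i) (measurableT_comp mH measurable_snd)).
have mE : measurable E.
  suff mB' : measurable ((fun z : 'rV[R]_n * 'rV[R]_n => z.1 + H z.2) @^-1` B).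
    by apply: measurableI mB'; apply: measurable_rV_fun.
  apply: measurable_rV_fun => // i.
  by under eq_fun do rewrite mxE; apply: measurable_funD.
have mF : measurable F.
  suff mC' : measurable ((fun z : 'rV[R]_n * 'rV[R]_n => z.1 - H z.2) @^-1` C).
    by apply: measurableI mC'; apply: measurable_rV_fun.
  apply: measurable_rV_fun => // i.
  by under eq_fun do rewrite !mxE; apply: measurable_funB.
have EC : (mu \x mu)%E E = (mu C * mu (H @^-1` B))%E.
  rewrite -product_measure1E//; apply: product_measure1_eq => x.
  have [Cx|nCx] := pselect (C x); last first.
    congr (lebesgue_rV R n _); apply/seteqP; split => y.
      by rewrite /xsection/= !inE => -[].
    by rewrite /xsection/= !inE => -[].
  rewrite -[RHS](@lebesgue_rV_translation n (H x)); last first.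
    exact: measurable_xsection (measurableX mC mHB).
  congr (lebesgue_rV R n _); apply/seteqP; split => y;
    by rewrite /xsection/= !inE /preimage /E/= HD HK addrC => -[].
have EF : (mu \x^ mu)%E E = (mu \x^ mu)%E F.
  rewrite /product_measure2; apply: eq_integral => y _ /=.
  rewrite -[LHS](@lebesgue_rV_translation n (- H y)); last exact: measurable_ysection.
  congr (lebesgue_rV R n _); apply/seteqP; split => x;
    by rewrite /ysection/= !inE /E /F/= subrK; tauto.
have FB : (mu \x mu)%E F = (mu B * mu C)%E.
  rewrite -product_measure1E//; apply: product_measure1_eq => x.
  have [Bx|nBx] := pselect (B x); last first.
    congr (lebesgue_rV R n _); apply/seteqP; split => y.
      by rewrite /xsection/= !inE => -[].
    by rewrite /xsection/= !inE => -[].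
  rewrite -[RHS](@lebesgue_rV_translation n (- H x)); last first.
    exact: measurable_xsection (measurableX mB mC).
  have Cxy y : C (x - H y) <-> C (y - H x).
    have HN v : H (- v) = - H v.
      apply/eqP; rewrite -addr_eq0 -HD addNr; apply/eqP; apply: (addrI (H 0)).
      by rewrite -HD !addr0.
    by rewrite /C /unit_ball/= -enormH HD HN HK -opprB enormN.
  congr (lebesgue_rV R n _); apply/seteqP; split => y;
    by rewrite /xsection/= !inE /preimage /F/= => -[_ /Cxy].
have := product_measure_swap mE; rewrite -/mu EC EF -product_measure_swap// -/mu FB.
have [r r0 ->] := unit_ball_fin n; rewrite [RHS]muleC.
move=> /(congr1 (fun t => (r^-1)%:E * t)%E).
by rewrite !muleA -EFinM mulVf ?gt_eqF// !mul1e.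
Qed.

End isometry.

Lemma measurable_mirror n (e : 'rV[R]_n) l : measurable_fun setT (mirror e l).
Proof.
apply: measurable_fun_coordP => i; rewrite /mirror.
under eq_fun do rewrite !mxE.
apply: measurable_funD; first exact: measurable_coord.
apply: measurable_funM => //; apply: measurable_funM => //.
by apply: measurable_funB => //; exact: measurable_dotv.
Qed.

(** A mirror is a linear isometry followed by a translation. *)
Lemma lebesgue_rV_mirror n (e : 'rV[R]_n) l (B : set 'rV[R]_n) : dotv e e = 1 ->
  measurable B -> lebesgue_rV R n (mirror e l @^-1` B) = lebesgue_rV R n B.
Proof.
move=> e1 mB; pose a := (2 * l) *: e.
have mirrorE x : mirror e l x = mirror e 0 x + a.
  by rewrite /mirror -addrA -scalerDl; congr (_ + _ *: _); ring.
rewrite -(lebesgue_rV_translation a mB).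
have -> : mirror e l @^-1` B = mirror e 0 @^-1` ((fun x => x + a) @^-1` B).
  by apply/funext => x; rewrite /preimage/= mirrorE.
apply: lebesgue_rV_isometry.
- exact: measurable_mirror.
- exact: mirrorK.
- by move=> x y; rewrite /mirror dotvDl addrACA -scalerDl; congr (_ + _ *: _); ring.
- move=> x; have r0 : mirror e 0 0 = 0.
    by rewrite mirror_fixed// dotv0l.
  by have := enorm_mirror e1 0 x 0; rewrite r0 !subr0.
- by rewrite -[X in measurable X]setTI; exact: measurable_fun_addrV.
Qed.

Section integral_mirror.
Variables (n : nat) (e : 'rV[R]_n) (l : R).
Hypothesis e1 : dotv e e = 1.
Let mu := lebesgue_rV R n.
Local Open Scope ereal_scope.

Let integral_pushforward_mirror (f : 'rV[R]_n -> \bar R) :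
  \int[pushforward mu (mirror e l)]_x f x = \int[mu]_x f x.
Proof.
apply: eq_measure_integral; first exact: measurable_mirror.
by move=> mmirror A mA _; exact: lebesgue_rV_mirror.
Qed.

Lemma integrable_mirror (f : 'rV[R]_n -> \bar R) :
  mu.-integrable setT f -> mu.-integrable setT (f \o mirror e l).
Proof.
move=> /integrableP[mf foo]; apply/integrableP; split.
  exact: measurableT_comp mf (measurable_mirror e l).
apply: le_lt_trans foo; rewrite -(integral_pushforward_mirror (fun x => `|f x|)).
rewrite ge0_integral_pushforward//; first exact: measurable_mirror.
exact: measurableT_comp.
Qed.

Lemma Rintegral_mirror (f : 'rV[R]_n -> R) :
  mu.-integrable setT (EFin \o f) ->
  (\int[mu]_x f (mirror e l x) = \int[mu]_x f x)%R.
Proof.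
move=> intf; congr fine.
rewrite -(integral_pushforward_mirror (EFin \o f)) integral_pushforward//.
- exact: measurable_mirror.
- by case/integrableP : intf.
- exact: integrable_mirror.
Qed.

End integral_mirror.

End lebesgue_rV_invariance.

(** * The maximum principle for antisymmetric functions *)

(** The algebra of pairing [y] with its mirror image: here [a] is the value of
    the antisymmetric function at the minimum, [b] and [- b] are its values at
    [y] and at the image, [k1] and [k2] those of the kernel. *)
Lemma symmetric_pair_le (R : realFieldType) (a b k1 k2 c i : R) :
  c <= (b - a) * (k1 - k2) - 2 * a * k2 -> 0 <= i ->
  (a - b) * k1 + (a - - b) * k2 <= - c + i.
Proof. by move=> ? ?; lra. Qed.

Section reflected_laplacian.
Variables (R : realType) (N : nat) (alpha : R) (e : 'rV[R]_N) (l : R).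
Hypothesis e1 : dotv e e = 1.
Implicit Types (u w : 'rV[R]_N -> R) (x y : 'rV[R]_N).

Notation mirror := (mirror e l).
Notation mu := (lebesgue_rV R N).

Definition kernel (z : 'rV[R]_N) : R := (enorm z `^ (N%:R + 2 * alpha))^-1.

Definition outside x (eps : R) : set 'rV[R]_N := [set y | eps < enorm (x - y)].

Lemma frac_kernelE u x y : frac_kernel alpha u x y = (u x - u y) * kernel (x - y).
Proof. by []. Qed.

Lemma measurable_enorm_sub x : measurable_fun setT (fun y => enorm (x - y)).
Proof.
apply: (measurableT_comp (@measurable_enorm R N)).
apply: measurable_fun_coordP => i; under eq_fun do rewrite !mxE.
by apply: measurable_funB => //; exact: measurable_coord.
Qed.

Lemma measurable_outside x eps : measurable (outside x eps).
Proof.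
rewrite -[X in measurable X]setTI.
apply: (@measurable_fun_ltr _ _ _ setT) => //; exact: measurable_enorm_sub.
Qed.

(** The mirror carries the truncated integrand at the image of [x] to the
    truncated integrand of [u o mirror] at [x]; this is what lets both principal
    values be compared with the same truncation. *)
Lemma kernel_restrict_mirror u x eps :
  (frac_kernel alpha u (mirror x) \_ (outside (mirror x) eps)) \o mirror =
  frac_kernel alpha (u \o mirror) x \_ (outside x eps).
Proof.
apply/funext => y; rewrite /= !patchE.
have -> : (mirror y \in outside (mirror x) eps) = (y \in outside x eps).
  by apply/idP/idP; rewrite !inE /outside/= enorm_mirror.
by rewrite !frac_kernelE /kernel enorm_mirror.
Qed.

Lemma integrable_outsideP x eps (f : 'rV[R]_N -> R) :
  mu.-integrable (outside x eps) (EFin \o f) <->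
  mu.-integrable setT (EFin \o (f \_ (outside x eps))).
Proof.
rewrite integrable_mkcond; last exact: measurable_outside.
suff -> : (EFin \o f) \_ (outside x eps) = EFin \o (f \_ (outside x eps)) by [].
by apply/funext => y; rewrite /= !patchE; case: ifP.
Qed.

Section antisymmetrisation.
Variables (u : 'rV[R]_N -> R) (x : 'rV[R]_N).
Hypotheses (defx : frac_laplacian_defined alpha u x)
  (defrx : frac_laplacian_defined alpha u (mirror x)).

Let ker_mirror (eps : R) : 0 < eps ->
  mu.-integrable setT (EFin \o (frac_kernel alpha (u \o mirror) x \_ (outside x eps))).
Proof.
move=> e0; have /integrable_outsideP := defrx.1 _ e0.
move=> /(integrable_mirror l e1).
by rewrite -kernel_restrict_mirror.
Qed.

Let kerE eps : frac_kernel alpha (fun y => u (mirror y) - u y) x \_ (outside x eps) =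
   (fun y => (frac_kernel alpha (u \o mirror) x \_ (outside x eps)) y -
             (frac_kernel alpha u x \_ (outside x eps)) y).
Proof.
apply/funext => y; rewrite !patchE; case: ifP => _; last by rewrite subrr.
by rewrite !frac_kernelE/=; ring.
Qed.

Let ker_diff (eps : R) : 0 < eps -> mu.-integrable setT
  (EFin \o (frac_kernel alpha (fun y => u (mirror y) - u y) x \_ (outside x eps))).
Proof.
move=> e0; rewrite kerE.
have /integrable_outsideP := defx.1 _ e0.
exact: (integrableB _ (ker_mirror e0)).
Qed.

Let truncated_diff (eps : R) : 0 < eps ->
  frac_truncated alpha (fun y => u (mirror y) - u y) x eps =
  frac_truncated alpha u (mirror x) eps - frac_truncated alpha u x eps.
Proof.
move=> e0; rewrite /frac_truncated.
rewrite Rintegral_mkcond -/(outside x eps) kerE RintegralB//; last first.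
- exact/integrable_outsideP/(defx.1 _ e0).
- exact: ker_mirror.
congr (_ - _); last by rewrite [RHS]Rintegral_mkcond.
rewrite -kernel_restrict_mirror Rintegral_mirror//.
  by rewrite [RHS]Rintegral_mkcond.
exact/integrable_outsideP/(defrx.1 _ e0).
Qed.

Let cvg_diff : frac_truncated alpha (fun y => u (mirror y) - u y) x eps @[eps --> 0^'+] -->
  frac_laplacian alpha u (mirror x) - frac_laplacian alpha u x.
Proof.
apply: cvg_trans (cvgB defrx.2 defx.2); apply: near_eq_cvg.
by near=> eps; rewrite truncated_diff//; near: eps; exact: nbhs_right_gt.
Unshelve. all: by end_near. Qed.

(** Both truncations are removed at the same speed, so the principal value of
    the difference exists as soon as both principal values do. *)
Lemma frac_laplacian_defined_diff :
  frac_laplacian_defined alpha (fun y => u (mirror y) - u y) x.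
Proof.
split; last by apply/cvg_ex; eexists; exact: cvg_diff.
by move=> eps e0; apply/integrable_outsideP; exact: ker_diff.
Qed.

Lemma frac_laplacian_diff :
  frac_laplacian alpha (fun y => u (mirror y) - u y) x =
  frac_laplacian alpha u (mirror x) - frac_laplacian alpha u x.
Proof. exact/cvg_lim/cvg_diff. Qed.

End antisymmetrisation.

Let indic_integral (A : set 'rV[R]_N) (r : R) : measurable A -> mu A = r%:E ->
  mu.-integrable setT (EFin \o \1_A) /\ (\int[mu]_y \1_A y = r)%R.
Proof.
move=> mA Ar.
have intA : (\int[mu]_y (\1_A y)%:E = r%:E)%E by rewrite integral_indic// setIT.
split; last by rewrite /Rintegral intA.
apply/integrableP; split; first exact/measurable_EFinP.
under eq_integral do rewrite /= ger0_norm ?ler0n//.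
by rewrite intA ltry.
Qed.

Lemma kernel_ge0 z : 0 <= kernel z.
Proof. by rewrite invr_ge0 powR_ge0. Qed.

Hypothesis alpha0 : 0 < alpha.

Let expo_ge0 : 0 <= N%:R + 2 * alpha.
Proof. by rewrite addr_ge0// mulr_ge0// ltW. Qed.

Lemma kernel_le_powR (d : R) z : 0 < d -> d <= enorm z ->
  kernel z <= (d `^ (N%:R + 2 * alpha))^-1.
Proof.
move=> d0 dz; rewrite lef_pV2 ?posrE ?powR_gt0 ?(lt_le_trans d0)//.
by rewrite ge0_ler_powR// nnegrE ?enorm_ge0// ltW.
Qed.

Lemma powR_le_kernel (d : R) z : 0 < enorm z -> enorm z <= d ->
  (d `^ (N%:R + 2 * alpha))^-1 <= kernel z.
Proof.
move=> z0 zd; rewrite lef_pV2 ?posrE ?powR_gt0 ?(lt_le_trans z0)//.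
by rewrite ge0_ler_powR// nnegrE ?enorm_ge0// (le_trans _ zd)// ltW.
Qed.

Lemma kernel_mirror_le x y : dotv x e <= l -> dotv y e <= l -> 0 < enorm (x - y) ->
  kernel (x - mirror y) <= kernel (x - y).
Proof. by move=> xl yl xy0; apply: kernel_le_powR => //; exact: le_enorm_sub_mirror. Qed.

(** Replacing an integrand by its sum with its mirror image doubles the
    integral; signs that fail pointwise may hold for the sum. *)
Lemma Rintegral_symmetrised (f : 'rV[R]_N -> R) : mu.-integrable setT (EFin \o f) ->
  mu.-integrable setT (EFin \o (fun y => f y + f (mirror y))) /\
  \int[mu]_y (f y + f (mirror y)) = 2 * \int[mu]_y f y.
Proof.
move=> fi; have fri := integrable_mirror l e1 fi.
split; first exact: (integrableD measurableT fi fri).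
by rewrite (RintegralD measurableT fi fri) (Rintegral_mirror l e1 fi) mulr_natl mulr2n.
Qed.

Section maximum_principle.
Variables (w : 'rV[R]_N -> R) (x : 'rV[R]_N).
Hypotheses (w_mirror : forall y, w (mirror y) = - w y)
  (defw : frac_laplacian_defined alpha w x) (cw : {for x, continuous w})
  (xl : dotv x e < l) (wx : w x <= 0) (wmin : forall y, dotv y e < l -> w x <= w y).

Let wmin_le y : dotv y e <= l -> w x <= w y.
Proof.
rewrite le_eqVlt => /orP[/eqP yl|]; last exact: wmin.
suff -> : w y = 0 by [].
have := w_mirror y; rewrite mirror_fixed// => wy; lra.
Qed.

Variables (Q : set 'rV[R]_N) (v r c : R).
Hypotheses (mQ : measurable Q) (Qv : mu Q = v%:E) (r0 : 0 < r)
  (Ql : forall y, Q y -> dotv y e < l) (Qr : forall y, Q y -> r < `|x - y|) (c0 : 0 <= c)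
  (Qc : forall y, Q y -> c <=
    (w y - w x) * (kernel (x - y) - kernel (x - mirror y)) - 2 * w x * kernel (x - mirror y)).

Let G eps : 'rV[R]_N -> R := frac_kernel alpha w x \_ (outside x eps).

Section symmetrised_bound.
Variables (eps rho eta : R).
Hypotheses (eps0 : 0 < eps) (eps_r : eps <= r) (eps_rho : eps <= rho) (eta0 : 0 <= eta)
  (B_eta : forall y, `|y - x| <= rho -> (w y - w x) * kernel (x - mirror y) <= eta).

(** If [y] is outside the truncation ball, so is its image, and the pairing has
    the good sign. If [y] is inside, only the image may contribute, and this
    contribution [(w x + w y) * kernel (x - mirror y)] is at most [eta] since
    [w y] is close to [w x]: this is the error carried by the cube around [x]. *)
Let symmetrised_le_left y : dotv y e <= l ->
  G eps y + G eps (mirror y) <= - c * \1_Q y + eta * \1_(cube x rho) y.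
Proof.
move=> yl; have wxy := wmin_le yl.
have k2 := kernel_ge0 (x - mirror y).
have wk2 : 2 * w x * kernel (x - mirror y) <= 0 by rewrite mulr_le0_ge0// mulr_ge0_le0.
rewrite /G !patchE !frac_kernelE w_mirror.
have [yo|yno] := boolP (y \in outside x eps); last first.
  move: yno; rewrite notin_setE /outside/= => /negP; rewrite -leNgt => xy_eps.
  have xy_norm : `|x - y| <= eps by apply: le_trans xy_eps; exact: norm_le_enorm.
  have -> : \1_Q y = 0 :> R.
    by rewrite indicE memNset// => /Qr; rewrite ltNge (le_trans xy_norm).
  have yB : `|y - x| <= rho by rewrite distrC (le_trans xy_norm).
  have -> : \1_(cube x rho) y = 1 :> R by rewrite indicE mem_set.
  rewrite mulr0 mulr1 !add0r; case: ifP => // _.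
  by have := B_eta yB; lra.
have xy_eps : eps < enorm (x - y) by move: yo; rewrite inE.
have xy0 := lt_trans eps0 xy_eps.
have -> : mirror y \in outside x eps.
  by rewrite inE /outside/= (lt_le_trans xy_eps)// le_enorm_sub_mirror// ltW.
have k12 := kernel_mirror_le (ltW xl) yl xy0.
have wk12 : 0 <= (w y - w x) * (kernel (x - y) - kernel (x - mirror y)).
  by rewrite mulr_ge0// subr_ge0.
have B0 : 0 <= eta * \1_(cube x rho) y by rewrite mulr_ge0// indicE ler0n.
have [Qy|nQy] := pselect (Q y).
  have -> : \1_Q y = 1 :> R by rewrite indicE mem_set.
  by rewrite mulr1; apply: symmetric_pair_le => //; exact: Qc.
have -> : \1_Q y = 0 :> R by rewrite indicE memNset.
rewrite mulr0 -oppr0; apply: symmetric_pair_le => //.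
by rewrite subr_ge0; exact: le_trans wk2 wk12.
Qed.

Lemma symmetrised_le y : G eps y + G eps (mirror y) <=
  - c * \1_Q y + eta * (\1_(cube x rho) y + \1_(cube x rho) (mirror y)).
Proof.
have ind0 z : 0 <= eta * \1_(cube x rho) z by rewrite mulr_ge0// indicE ler0n.
have [yl|ly] := leP (dotv y e) l.
  by apply: le_trans (symmetrised_le_left yl) _; rewrite lerD2l mulrDr lerDl.
have ryl : dotv (mirror y) e <= l by rewrite dotv_mirror// lerBlDr mulr_natl mulr2n lerD2l ltW.
have := symmetrised_le_left ryl; rewrite mirrorK// addrC => /le_trans; apply.
have -> : \1_Q y = 0 :> R.
  by rewrite indicE memNset// => /Ql; rewrite ltNge ltW.
rewrite mulr0 add0r mulrDr lerD2r (le_trans _ (ind0 y))//.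
by rewrite mulNr oppr_le0 mulr_ge0// indicE ler0n.
Qed.

Lemma truncated_le : 2 * frac_truncated alpha w x eps <=
  - (c * v) + 2 * eta * (2 * rho) ^+ N.
Proof.
have rho0 : 0 <= rho by exact: le_trans (ltW eps0) eps_rho.
have iG : mu.-integrable setT (EFin \o G eps).
  exact/integrable_outsideP/(defw.1 _ eps0).
have [iQ IQ] := indic_integral mQ Qv.
have [iB IB] := indic_integral (measurable_cube x rho0) (lebesgue_rV_cube x rho0).
have [iGG IGG] := Rintegral_symmetrised iG.
have [iBB IBB] := Rintegral_symmetrised iB.
have icQ := integrableZl measurableT (- c) iQ.
have ieB := integrableZl measurableT eta iBB.
have -> : frac_truncated alpha w x eps = \int[mu]_y G eps y := Rintegral_mkcond _ _ _.
rewrite -IGG.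
have -> : - (c * v) + 2 * eta * (2 * rho) ^+ N = \int[mu]_y
    (- c * \1_Q y + eta * (\1_(cube x rho) y + \1_(cube x rho) (mirror y))).
  rewrite [RHS](RintegralD measurableT icQ ieB) (RintegralZl (- c) measurableT iQ).
  rewrite (RintegralZl eta measurableT iBB) IBB IQ IB.
  by rewrite mulNr mulrA [eta * 2]mulrC.
apply: le_Rintegral => //.
- exact: (integrableD measurableT icQ ieB).
- by move=> y _; exact: symmetrised_le.
Qed.

End symmetrised_bound.

(** Near [x] the mirror images stay away from [x], so the kernel is bounded
    there, while [w y - w x] is small by continuity. *)
Lemma near_small_correction (eta : R) : 0 < eta -> exists2 rho, 0 < rho <= 1 &
  forall y, `|y - x| <= rho -> (w y - w x) * kernel (x - mirror y) <= eta.
Proof.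
move=> eta0; set d := l - dotv x e; have d0 : 0 < d by rewrite subr_gt0.
pose k := d `^ (N%:R + 2 * alpha).
have k0 : 0 < k by rewrite powR_gt0.
have : \forall y \near x, `|w x - w y| < eta * k /\ `|dotv x e - dotv y e| < d / 2.
  near=> y; split; near: y.
    by move/cvgrPdist_lt : cw; apply; rewrite mulr_gt0.
  by have /cvgrPdist_lt := @continuous_dotv R N e x; apply; rewrite divr_gt0.
move=> /nbhs_ballP[s /= s0 sP].
exists (Num.min (s / 2) 1); first by rewrite lt_min divr_gt0 ?ltr01 ?ge_min ?lexx ?orbT.
move=> y; rewrite le_min => /andP[ys _].
have [] := sP y.
  by rewrite -ball_normE/= distrC (le_lt_trans ys)// ltr_pdivrMr// ltr_pMr// ltr1n.
move=> wxy dxy.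
have kd : kernel (x - mirror y) <= k^-1.
  apply: kernel_le_powR => //; rewrite -(ler_pXn2r (n := 2))// ?nnegrE ?enorm_ge0 ?(ltW d0)//.
  rewrite sqr_enorm_sub_mirror// -/d.
  have : d / 2 <= l - dotv y e by move: dxy; rewrite /d ltr_norml => /andP[]; lra.
  have := sqr_ge0 (enorm (x - y)); nra.
apply: (@le_trans _ _ (`|w x - w y| * kernel (x - mirror y))).
  by rewrite ler_wpM2r ?kernel_ge0// distrC ler_norm.
apply: (@le_trans _ _ (eta * k * k^-1)); last by rewrite mulfK// gt_eqF.
by apply: ler_pM => //; [exact: kernel_ge0|exact: ltW].
Unshelve. all: by end_near. Qed.

(** At a nonpositive minimum over the half-space the symmetrised integrand is
    nonpositive up to the correction near [x], so the integral is at most its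
    part over any test set [Q]; the correction disappears with the truncation. *)
Lemma antisymmetric_maximum_principle : 2 * frac_laplacian alpha w x <= - (c * v).
Proof.
apply/ler_addgt0Pr => eta eta0.
have [] := @near_small_correction (eta / (2 * 2 ^+ N)).
  by rewrite divr_gt0// mulr_gt0// exprn_gt0.
move=> rho /andP[rho0 rho1] Brho.
rewrite -ler_pdivlMl//; apply: limr_le; first exact: defw.2.
near=> eps.
have eps0 : 0 < eps by near: eps; exact: nbhs_right_gt.
have eps_r : eps <= r by near: eps; exact: nbhs_right_le.
have eps_rho : eps <= rho by near: eps; exact: nbhs_right_le.
rewrite ler_pdivlMl//; apply: le_trans (truncated_le eps0 eps_r eps_rho _ Brho) _.
  by rewrite divr_ge0 ?(ltW eta0)// mulr_ge0// exprn_ge0.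
rewrite lerD2l.
have -> : 2 * (eta / (2 * 2 ^+ N)) * (2 * rho) ^+ N = eta * rho ^+ N.
  by rewrite exprMn; field; rewrite expf_neq0.
by rewrite ler_piMr ?(ltW eta0)// exprn_ile1// ltW.
Unshelve. all: by end_near. Qed.

End maximum_principle.
End reflected_laplacian.

(** * Two consequences of the maximum principle *)

Lemma continuous_enorm_sub (R : realType) (N : nat) (c : 'rV[R]_N) :
  continuous (fun y : 'rV[R]_N => enorm (c - y)).
Proof.
move=> y; apply: (@continuous_comp _ _ _ (fun y : 'rV[R]_N => c - y) (@enorm R N)).
  by apply: continuousB; [exact: cst_continuous|exact: cvg_id].
exact: continuous_enorm.
Qed.

Section consequences.
Variables (R : realType) (N : nat) (alpha : R).
Hypotheses (N0 : (0 < N)%N) (alpha0 : 0 < alpha).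

Definition narrow_constant : R :=
  (2 / N%:R) ^+ N / (6 * N%:R) `^ (N%:R + 2 * alpha).

Lemma narrow_constant_gt0 : 0 < narrow_constant.
Proof.
by rewrite divr_gt0 ?exprn_gt0 ?powR_gt0 ?divr_gt0 ?mulr_gt0 ?ltr0n.
Qed.

Variables (e : 'rV[R]_N) (l : R).
Hypothesis e1 : dotv e e = 1.
Variables (w : 'rV[R]_N -> R) (x : 'rV[R]_N).
Hypotheses (w_mirror : forall y, w (mirror e l y) = - w y)
  (defw : frac_laplacian_defined alpha w x) (cw : continuous w)
  (xl : dotv x e < l) (wx : w x <= 0) (wmin : forall y, dotv y e < l -> w x <= w y).

(** With [d := l - x . e], a cube of size comparable to [d], at distance
    comparable to [d] from [x] and from the hyperplane, has its mirror image at
    distance comparable to [d] from [x] too. There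
    [kernel (x - mirror e l y)] is at least a multiple of [d^-(N + 2 alpha)],
    and the volume is a multiple of [d^N]. *)
Lemma narrow_region_estimate :
  frac_laplacian alpha w x <= w x * (narrow_constant / (l - dotv x e) `^ (2 * alpha)).
Proof.
set d := l - dotv x e; have d0 : 0 < d by rewrite subr_gt0.
have NR0 : 0 < N%:R :> R by rewrite ltr0n.
have NR1 : 1 <= N%:R :> R by rewrite ler1n.
pose h := d / N%:R; have h0 : 0 < h by rewrite divr_gt0.
have hd : h <= d by rewrite ler_pdivrMr// ler_peMr// ltW.
(* The cube is centred 3 d below x, hence clear of x and of the hyperplane: it
   spreads by at most d in the direction e. *)
pose z := x - (3 * d) *: e.
pose k := ((6 * N%:R * d) `^ (N%:R + 2 * alpha))^-1.
have k0 : 0 < k by rewrite invr_gt0 powR_gt0 ?mulr_gt0.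
have dot_z y : cube z h y -> `|dotv y e - (dotv x e - 3 * d)| <= d.
  move=> yz; have -> : dotv y e - (dotv x e - 3 * d) = dotv (y - z) e.
    by rewrite /z !(dotvDl, dotvNl, dotvZl) e1 mulr1.
  apply: (le_trans (normr_dotv_unit e1 _)).
  by rewrite -ler_pdivlMl// mulrC; exact: yz.
have Ql y : cube z h y -> dotv y e < l.
  move=> /dot_z; rewrite ler_norml => /andP[_]; rewrite /d; move: d0; rewrite /d; lra.
have Qr y : cube z h y -> d / N%:R < `|x - y|.
  move=> yz; rewrite ltr_pdivrMr//.
  have : 2 * d <= `|dotv (x - y) e|.
    rewrite dotvDl dotvNl; apply: le_trans (ler_norm _).
    by move: (dot_z _ yz); rewrite ler_norml => /andP[_]; lra.
  move=> /le_trans/(_ (normr_dotv_unit e1 _)) H; rewrite [ltRHS]mulrC; apply: lt_le_trans H.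
  by rewrite mulr_natl mulr2n ltrDl.
have Qk y : cube z h y -> k <= kernel alpha (x - mirror e l y).
  move=> yz; apply: powR_le_kernel => //.
    by apply: le_lt_trans (lt_enorm_sub_mirror e1 xl (Ql _ yz)); exact: enorm_ge0.
  rewrite enorm_sub_mirror//; apply: (le_trans (enorm_le_norm _)).
  rewrite [6 * _]mulrC -mulrA ler_wpM2l ?ler0n//.
  have -> : mirror e l x - y = (5 * d) *: e - (y - z).
    by rewrite /mirror -/d /z; apply/rowP => i; rewrite !mxE; ring.
  apply: (le_trans (ler_normB _ _)).
  have -> : 6 * d = 5 * d * 1 + d by ring.
  apply: lerD; last by apply: le_trans hd; exact: yz.
  by rewrite normrZ gtr0_norm ?mulr_gt0// ler_wpM2l ?mulr_ge0 ?(ltW d0)// norm_unit.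
have c0 : 0 <= - 2 * w x * k.
  by rewrite mulNr mulNr oppr_ge0 mulr_le0_ge0 ?(ltW k0)// mulr_ge0_le0.
have Qc y : cube z h y -> - 2 * w x * k <=
    (w y - w x) * (kernel alpha (x - y) - kernel alpha (x - mirror e l y)) -
    2 * w x * kernel alpha (x - mirror e l y).
  move=> Qy; have wxy := wmin (Ql _ Qy).
  have k12 : kernel alpha (x - mirror e l y) <= kernel alpha (x - y).
    apply: kernel_mirror_le => //; [exact: ltW|exact/ltW/Ql|].
    by apply: lt_le_trans (norm_le_enorm _); apply: le_lt_trans (Qr _ Qy); exact: ltW.
  have h1 : 0 <= (w y - w x) * (kernel alpha (x - y) - kernel alpha (x - mirror e l y)).
    by rewrite mulr_ge0// subr_ge0.
  have w2 : 2 * w x <= 0 by rewrite mulr_ge0_le0.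
  have h2 := ler_wnM2l w2 (Qk _ Qy).
  by rewrite !mulNr -[leLHS]add0r; apply: (lerD h1); rewrite lerN2.
have cwx : {for x, continuous w} by exact: cw.
have := antisymmetric_maximum_principle e1 alpha0 w_mirror defw cwx xl wx wmin
  (measurable_cube z (ltW h0)) (lebesgue_rV_cube z (ltW h0)) h0 Ql Qr c0 Qc.
have -> : narrow_constant / d `^ (2 * alpha) = k * (2 * h) ^+ N.
  have NR2 : N%:R != 0 :> R by rewrite gt_eqF.
  have dp : d `^ (N%:R + 2 * alpha) = d ^+ N * d `^ (2 * alpha).
    by rewrite powRD ?(gt_eqF d0) ?implybT// powR_mulrn// ltW.
  have pM : (6 * N%:R * d) `^ (N%:R + 2 * alpha) =
      (6 * N%:R) `^ (N%:R + 2 * alpha) * (d ^+ N * d `^ (2 * alpha)).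
    by rewrite powRM ?mulr_ge0 ?(ltW d0)// dp.
  have hM : (2 * h) ^+ N = (2 / N%:R) ^+ N * d ^+ N by rewrite -exprMn /h mulrAC mulrA.
  rewrite /k pM hM /narrow_constant.
  have A0 : (6 * N%:R) `^ (N%:R + 2 * alpha) != 0 by rewrite gt_eqF// powR_gt0// mulr_gt0.
  have P0 : d `^ (2 * alpha) != 0 by rewrite gt_eqF// powR_gt0.
  have D0 : d ^+ N != 0 by rewrite expf_neq0// gt_eqF.
  by field; rewrite A0 P0 D0.
rewrite !mulNr opprK -(mulrA _ k) -mulrA; move: (k * _) (w x) (frac_laplacian _ _ _) => K a F.
by rewrite ler_pM2l.
Qed.

(** If [w] were positive at some [y0], both factors of
    [(w y - w x) * (kernel (x - y) - kernel (x - mirror y))] would be bounded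
    below by positive constants on a small cube around [y0], and the fractional Laplacian at [x] would be
    negative. *)
Lemma strong_maximum_principle :
  w x = 0 -> 0 <= frac_laplacian alpha w x -> forall y, dotv y e < l -> w y = 0.
Proof.
move=> wx0 F0 y0 y0l; apply/eqP; rewrite eq_le -{2}wx0 wmin// andbT leNgt; apply/negP => wy0.
have s0 : 0 < N%:R + 2 * alpha by rewrite ltr_wpDl// mulr_gt0.
have xy0 : 0 < `|x - y0|.
  by rewrite normr_gt0 subr_eq0; apply: contraPneq wy0 => <-; rewrite wx0 ltxx.
set a := enorm (x - y0); set b := enorm (x - mirror e l y0).
have ab : a < b by exact: lt_enorm_sub_mirror.
have a0 : 0 < a by exact: lt_le_trans xy0 (norm_le_enorm _).
(* The thresholds m < m' separate the distances of x to y0 and to its mirror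
   image, with room for y to move. *)
pose m := a + (b - a) / 3; pose m' := b - (b - a) / 3.
have m0 : 0 < m by rewrite addr_gt0// divr_gt0// subr_gt0.
have mm' : m < m' by rewrite /m /m'; move: ab; lra.
have m'0 := lt_trans m0 mm'.
pose k := (m `^ (N%:R + 2 * alpha))^-1 - (m' `^ (N%:R + 2 * alpha))^-1.
have k0 : 0 < k.
  by rewrite subr_gt0 ltf_pV2 ?posrE ?powR_gt0// gt0_ltr_powR// nnegrE ltW.
have ba0 : 0 < (b - a) / 3 by rewrite divr_gt0// subr_gt0.
have : \forall y \near y0, [/\ dotv y e < l, `|x - y0| / 2 < `|x - y|,
    w y0 / 2 <= w y, enorm (x - y) <= m & m' <= enorm (x - mirror e l y)].
  near=> y; split; near: y.
  - by apply: (@cvgr_lt _ _ _ _ _ (dotv y0 e)) => //; exact: continuous_dotv.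
  - apply: (@cvgr_gt _ _ _ _ (fun y : 'rV[R]_N => `|x - y|) `|x - y0|); last first.
      by rewrite ltr_pdivrMr// ltr_pMr// ltr1n.
    by apply: cvg_norm; apply: cvgB; [exact: cvg_cst|exact: cvg_id].
  - apply: (@cvgr_ge _ _ _ _ w (w y0)); last by rewrite ltr_pdivrMr// ltr_pMr// ltr1n.
    exact: cw.
  - apply: (@cvgr_le _ _ _ _ (fun y : 'rV[R]_N => enorm (x - y)) a); last by rewrite /m ltrDl.
    exact: continuous_enorm_sub.
  - under eq_near do rewrite enorm_sub_mirror//.
    apply: (@cvgr_ge _ _ _ _ (fun y : 'rV[R]_N => enorm (mirror e l x - y)) b).
      by rewrite /b enorm_sub_mirror//; exact: continuous_enorm_sub.
    by rewrite /m' ltrBlDr ltrDl.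
move=> /nbhs_ballP[t /= t0 tP].
pose h := t / 2; have h0 : 0 < h by rewrite divr_gt0.
have Qall y : cube y0 h y -> [/\ dotv y e < l, `|x - y0| / 2 < `|x - y|,
    w y0 / 2 <= w y, enorm (x - y) <= m & m' <= enorm (x - mirror e l y)].
  move=> yh; apply: tP; rewrite -ball_normE/= distrC (le_lt_trans yh)//.
  by rewrite ltr_pdivrMr// ltr_pMr// ltr1n.
have c0 : 0 < w y0 / 2 * k by rewrite !mulr_gt0.
have Qc y : cube y0 h y -> w y0 / 2 * k <=
    (w y - w x) * (kernel alpha (x - y) - kernel alpha (x - mirror e l y)) -
    2 * w x * kernel alpha (x - mirror e l y).
  move=> Qy; have [yl yr wy ym ym'] := Qall _ Qy.
  rewrite wx0 mulr0 mul0r !subr0; apply: ler_pM => //; [|exact: ltW|].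
    by rewrite divr_ge0// ltW.
  apply: lerB; last exact: kernel_le_powR.
  apply: powR_le_kernel => //.
  apply: lt_le_trans (norm_le_enorm _); apply: le_lt_trans yr.
  by rewrite divr_ge0.
have r0 : 0 < `|x - y0| / 2 by rewrite divr_gt0.
have Ql y : cube y0 h y -> dotv y e < l by move=> /Qall[].
have Qr y : cube y0 h y -> `|x - y0| / 2 < `|x - y| by move=> /Qall[].
have cwx : {for x, continuous w} by exact: cw.
have := antisymmetric_maximum_principle e1 alpha0 w_mirror defw cwx xl wx wmin
  (measurable_cube y0 (ltW h0)) (lebesgue_rV_cube y0 (ltW h0)) r0 Ql Qr (ltW c0) Qc.
rewrite leNgt => /negP; apply; apply: (@lt_le_trans _ _ 0).
  by rewrite oppr_lt0 mulr_gt0// exprn_gt0// mulr_gt0.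
by rewrite mulr_ge0.
Unshelve. all: by end_near.
Qed.

End consequences.

(** * Moving planes *)

Section moving_planes.
Variables (R : realType) (N : nat) (alpha : R) (f : R -> R) (u : 'rV[R]_N -> R).
Hypotheses (N0 : (0 < N)%N) (alpha0 : 0 < alpha).
Hypotheses (u_cont : continuous u) (u_gt0 : forall x, 0 < u x)
  (u_infty : u x @[x --> at_infinity] --> 0)
  (u_def : forall x, frac_laplacian_defined alpha u x)
  (u_eq : forall x, frac_laplacian alpha u x = f (u x)).

Lemma small_at_infinity (eta : R) : 0 < eta ->
  exists M, forall x, M < enorm x -> u x < eta.
Proof.
move=> eta0; have /cvgrPdist_lt/(_ _ eta0)[M _ MP] := u_infty.
exists M => x /MP/=; rewrite sub0r normrN; exact: le_lt_trans (ler_norm _).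
Qed.

(** A period would propagate the positive value [u 0] to infinity. *)
Lemma not_periodic v : v != 0 -> ~ (forall x, u (x + v) = u x).
Proof.
move=> v0 uv; have [M MP] := small_at_infinity (u_gt0 0).
have vn0 : 0 < enorm v.
  by rewrite lt_neqAle enorm_ge0 andbT eq_sym; apply: contra_neq v0; exact: enorm_eq0.
have un (n : nat) : u (n%:R *: v) = u 0.
  by elim: n => [|n ih]; rewrite ?scale0r// -natr1 scalerDl scale1r uv.
have [n Mn] : exists n : nat, M < n%:R * enorm v.
  exists (Num.truncn (M / enorm v)).+1; rewrite -ltr_pdivrMr//; exact: Num.Theory.truncnS_gt.
have := MP (n%:R *: v); rewrite enormZ ger0_norm// => /(_ Mn).
by rewrite un ltxx.
Qed.

Lemma compact_halfball (e : 'rV[R]_N) (M l : R) :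
  compact [set y : 'rV[R]_N | dotv y e <= l /\ enorm y <= M].
Proof.
apply: bounded_closed_compact.
  exists M; split; first exact: num_real.
  move=> K MK y /= [_ yM]; apply: le_trans (norm_le_enorm _) _.
  exact: le_trans yM (ltW MK).
apply: closedI.
  apply: (@preimage_closed _ _ (fun y : 'rV[R]_N => dotv y e) [set t | t <= l]).
    by move=> y _; exact: continuous_dotv.
  exact: closed_le.
apply: (@preimage_closed _ _ (@enorm R N) [set t | t <= M]).
  by move=> y _; exact: continuous_enorm.
exact: closed_le.
Qed.

Section direction.
Variable e : 'rV[R]_N.
Hypothesis e1 : dotv e e = 1.

Definition reflected_diff (l : R) (y : 'rV[R]_N) : R := u (mirror e l y) - u y.

Lemma reflected_diff_mirror l y : reflected_diff l (mirror e l y) = - reflected_diff l y.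
Proof. by rewrite /reflected_diff mirrorK// opprB. Qed.

Lemma continuous_mirror : continuous (fun z : R * 'rV[R]_N => mirror e z.1 z.2).
Proof.
move=> z; apply: (@continuousD _ _ _ snd
  (fun z : R * 'rV[R]_N => (2 * (z.1 - dotv z.2 e)) *: e)); first exact: cvg_snd.
apply: (@continuousZr_tmp _ _ _ (fun z : R * 'rV[R]_N => 2 * (z.1 - dotv z.2 e)) e).
apply: (@continuousM _ _ (cst 2) (fun z : R * 'rV[R]_N => z.1 - dotv z.2 e)).
  exact: cst_continuous.
apply: (@continuousB _ _ _ fst (fun z : R * 'rV[R]_N => dotv z.2 e)); first exact: cvg_fst.
apply: (@continuous_comp _ _ _ snd (fun y => dotv y e)); first exact: cvg_snd.
exact: continuous_dotv.
Qed.

Lemma continuous_reflected_diff2 :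
  continuous (fun z : R * 'rV[R]_N => reflected_diff z.1 z.2).
Proof.
move=> z; apply: (@continuousB _ _ _ (fun z : R * 'rV[R]_N => u (mirror e z.1 z.2)) (u \o snd)).
  apply: (@continuous_comp _ _ _ (fun z : R * 'rV[R]_N => mirror e z.1 z.2) u).
    exact: continuous_mirror.
  exact: u_cont.
by apply: (@continuous_comp _ _ _ snd u); [exact: cvg_snd|exact: u_cont].
Qed.

Lemma continuous_reflected_diff l : continuous (reflected_diff l).
Proof.
move=> y; apply: (@continuous_comp _ _ _ (fun y : 'rV[R]_N => (l, y))
  (fun z : R * 'rV[R]_N => reflected_diff z.1 z.2)); last exact: continuous_reflected_diff2.
apply: (@cvg_pair _ _ _ (nbhs y) (nbhs l) (nbhs y) _ _ _ (cst l) id).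
  exact: cvg_cst.
exact: cvg_id.
Qed.

Lemma continuous_reflected_diffl y : continuous (reflected_diff ^~ y).
Proof.
move=> l; apply: (@continuous_comp _ _ _ (fun l : R => (l, y))
  (fun z : R * 'rV[R]_N => reflected_diff z.1 z.2)); last exact: continuous_reflected_diff2.
apply: (@cvg_pair _ _ _ (nbhs l) (nbhs l) (nbhs y) _ _ _ id (cst y)).
  exact: cvg_id.
exact: cvg_cst.
Qed.

(** Outside a large ball [u] is smaller than [- w y0], hence [w > w y0] there;
    the minimum is sought in the remaining compact set, and it is not on the
    hyperplane, where [w = 0]. *)
Lemma negative_minimum l y0 : dotv y0 e < l -> reflected_diff l y0 < 0 ->
  exists x, [/\ dotv x e < l, reflected_diff l x < 0 &
    forall y, dotv y e < l -> reflected_diff l x <= reflected_diff l y].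
Proof.
move=> y0l w0.
have [M MP] : exists M, forall x, M < enorm x -> u x < - reflected_diff l y0.
  by apply: small_at_infinity; rewrite oppr_gt0.
have far y : M < enorm y -> reflected_diff l y0 < reflected_diff l y.
  by move=> /MP; rewrite {3}/reflected_diff; have := u_gt0 (mirror e l y); lra.
pose A := [set y : 'rV[R]_N | dotv y e <= l /\ enorm y <= M].
have y0A : A y0.
  by split; [exact: ltW|rewrite leNgt; apply/negP => /far; rewrite ltxx].
have [] := @EVT_min_rV _ _ (reflected_diff l) A.
- by exists y0.
- exact: compact_halfball.
- by apply: continuous_subspaceT => y; exact: continuous_reflected_diff.
move=> c /set_mem[cl cM] cmin.
have cy0 : reflected_diff l c <= reflected_diff l y0 by apply: cmin; rewrite inE.
exists c; split; last 2 first.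
- exact: le_lt_trans cy0 w0.
- move=> y yl; have [yM|My] := leP (enorm y) M.
    by apply: cmin; rewrite inE; split => //; exact: ltW.
  by apply: le_trans cy0 _; exact/ltW/far.
rewrite lt_neqAle cl andbT; apply/eqP => cel.
by have := le_lt_trans cy0 w0; rewrite /reflected_diff mirror_fixed// subrr ltxx.
Qed.

Lemma frac_laplacian_reflected_diff l x :
  frac_laplacian alpha (reflected_diff l) x = f (u (mirror e l x)) - f (u x).
Proof. by rewrite (@frac_laplacian_diff _ _ alpha e l e1 u x)// !u_eq. Qed.

(** A zero of [w] is a minimum at which the values of [u] at the point and at
    its image agree, and so do the values of [f]: the fractional Laplacian of
    [w] vanishes there. *)
Lemma reflected_diff_dichotomy l :
  (forall y, dotv y e < l -> 0 <= reflected_diff l y) ->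
  (forall y, dotv y e < l -> reflected_diff l y = 0) \/
  (forall y, dotv y e < l -> 0 < reflected_diff l y).
Proof.
move=> ge0.
have [[x [xl x0]]|no_zero] :=
  pselect (exists x, dotv x e < l /\ reflected_diff l x = 0).
  left.
  have wmin y : dotv y e < l -> reflected_diff l x <= reflected_diff l y.
    by rewrite x0; exact: ge0.
  have x0le : reflected_diff l x <= 0 by rewrite x0.
  have := (strong_maximum_principle alpha0 e1 (reflected_diff_mirror l)
    (frac_laplacian_defined_diff e1 (u_def x) (u_def _)) (@continuous_reflected_diff l)
    xl x0le wmin x0); apply.
  rewrite frac_laplacian_reflected_diff.
  by move/eqP : x0; rewrite subr_eq0 => /eqP ->; rewrite subrr.
right=> y yl; rewrite lt_neqAle ge0// andbT eq_sym; apply/eqP => y0.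
by apply: no_zero; exists y.
Qed.

End direction.

Hypotheses
  (f_decr : exists2 s : R, 0 < s &
    forall a b, 0 < a -> a <= b -> b <= s -> f b <= f a)
  (f_lip : forall M, exists L,
    forall a b, 0 < a -> a <= b -> b <= M -> f b - f a <= L * (b - a)).

(** The fractional Laplacian of [w] at a negative minimum is negative. Since [u]
    is smaller at the image than at the point, monotonicity of [f] near 0
    forbids small values of [u] and thus far away points; the Lipschitz bound
    makes the fractional Laplacian at least [L w x], which bounds the distance
    to the hyperplane from below by the narrow region estimate. Neither bound
    depends on the position of the hyperplane. *)
Lemma negative_minimum_location : exists M d, 0 < d /\
  forall e l x, dotv e e = 1 -> dotv x e < l -> reflected_diff e l x < 0 ->
    (forall y, dotv y e < l -> reflected_diff e l x <= reflected_diff e l y) ->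
    enorm x <= M /\ dotv x e <= l - d.
Proof.
have [s s0 f_le] := f_decr.
have [M MP] := small_at_infinity s0.
(* The normal 0 makes this half-ball the whole ball. *)
pose B := [set y : 'rV[R]_N | dotv y 0 <= 0 /\ enorm y <= M].
have [U UP] : exists U, forall x, enorm x <= M -> u x <= U.
  have [[z zM]|noM] := pselect (exists y0 : 'rV[R]_N, enorm y0 <= M); last first.
    by exists 0 => x xM; case: noM; exists x.
  have B0 y : enorm y <= M -> B y.
    by move=> yM; split => //; rewrite dotvC dotv0l.
  have [] := @EVT_max_rV _ _ u B.
  - by exists z; exact: B0.
  - exact: compact_halfball.
  - by apply: continuous_subspaceT => y; exact: u_cont.
  by move=> c _ cmax; exists (u c) => x xM; apply: cmax; rewrite inE; exact: B0.
have [L LP] := f_lip U.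
pose C := narrow_constant N alpha.
have C0 : 0 < C by exact: narrow_constant_gt0.
(* L may be nonpositive; the bound on d needs a positive constant. *)
pose L' := Num.max L 1; have L'0 : 0 < L' by rewrite lt_max ltr01 orbT.
exists M, ((C / L') `^ (2 * alpha)^-1); split; first by apply: powR_gt0; rewrite divr_gt0.
move=> e l x e1 xl wx wmin.
have u_lt : u (mirror e l x) < u x by rewrite -subr_lt0.
have est := @narrow_region_estimate _ _ _ N0 alpha0 e l e1 (reflected_diff e l) x
  (reflected_diff_mirror e1 l) (frac_laplacian_defined_diff e1 (u_def _) (u_def _))
  (@continuous_reflected_diff e l) xl (ltW wx) wmin.
rewrite frac_laplacian_reflected_diff// -/C in est.
set d := l - dotv x e in est; have d0 : 0 < d by rewrite subr_gt0.
have P0 : 0 < C / d `^ (2 * alpha) by rewrite divr_gt0// powR_gt0.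
have xM : enorm x <= M.
  rewrite leNgt; apply/negP => /MP/ltW /(f_le _ _ (u_gt0 _) (ltW u_lt)).
  by rewrite leNgt -subr_lt0 => /negP; apply; apply: le_lt_trans est _; rewrite pmulr_llt0.
split=> //.
have L'P : f (u x) - f (u (mirror e l x)) <= L' * (u x - u (mirror e l x)).
  apply: (le_trans (LP _ _ (u_gt0 _) (ltW u_lt) (UP _ xM))).
  by rewrite ler_wpM2r ?subr_ge0 ?(ltW u_lt)// le_max lexx.
have CL : C / d `^ (2 * alpha) <= L'.
  rewrite -(ler_nM2l wx); apply: le_trans est.
  by rewrite /reflected_diff mulrC -lerN2 !opprB -mulrN opprB.
rewrite lerBrDl addrC -lerBrDl -/d.
have a0 : 0 < 2 * alpha by rewrite mulr_gt0.
have -> : d = (d `^ (2 * alpha)) `^ (2 * alpha)^-1.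
  by rewrite -powRrM mulfV ?gt_eqF// powRr1// ltW.
apply: ge0_ler_powR; rewrite ?nnegrE ?invr_ge0 ?powR_ge0 ?(ltW a0)//.
  by rewrite divr_ge0// ltW.
by rewrite ler_pdivrMr// mulrC -ler_pdivrMr// powR_gt0.
Qed.

Section sliding.
Variable e : 'rV[R]_N.
Hypothesis e1 : dotv e e = 1.

Let w := reflected_diff e.

Let good := [set l : R | forall m, m <= l -> forall y, dotv y e < m -> 0 <= w m y].

(** The level [l] is the supremum of the levels up to which the plane can be
    moved. If [u] were not symmetric about it, [w l] would be positive on the
    half-space, and by compactness the plane could be moved further. *)
Lemma moving_planes : exists l, (forall y, u (mirror e l y) = u y) /\
  (forall m y, m < l -> dotv y e < m -> u y < u (mirror e m y)).
Proof.
have [M [d [d0 loc]]] := negative_minimum_location.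
have neg_loc l y : dotv y e < l -> w l y < 0 ->
    exists x, [/\ w l x < 0, enorm x <= M & dotv x e <= l - d].
  move=> yl wy; have [x [xl wx xmin]] := negative_minimum yl wy.
  by have [xM xd] := loc _ _ _ e1 xl wx xmin; exists x.
have start : good (- (N%:R * M)).
  move=> m mM y ym; rewrite leNgt; apply/negP => wy.
  have [x [_ xM xd]] := neg_loc _ _ ym wy.
  have : `|dotv x e| <= N%:R * M.
    apply: (le_trans (normr_dotv_unit e1 _)); rewrite ler_wpM2l//.
    exact: le_trans (norm_le_enorm _) xM.
  by rewrite ler_norml => /andP[+ _]; move: mM xd d0; lra.
have [M0 M0P] := small_at_infinity (u_gt0 0).
have bounded : ubound good (Num.max 0 M0).
  move=> l lgood; rewrite leNgt; apply/negP; rewrite gt_max => /andP[l0 M0l].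
  have := lgood l (lexx _) 0; rewrite dotv0l => /(_ l0).
  rewrite leNgt => /negP; apply; rewrite /w /reflected_diff subr_lt0; apply: M0P.
  rewrite /mirror dotv0l subr0 add0r enormZ enorm_unit// mulr1.
  by rewrite gtr0_norm ?mulr_gt0//; apply: lt_trans M0l _; rewrite ltr_pMl// ltr1n.
have supgood : has_sup good by split; [exists (- (N%:R * M))|exists (Num.max 0 M0)].
pose l := sup good.
have below m y : m < l -> dotv y e < m -> 0 <= w m y.
  move=> ml ym; have [] := @sup_adherent _ good (l - m) _ supgood.
    by rewrite subr_gt0.
  by move=> l' l'good; rewrite opprB addrC subrK => /ltW ml'; exact: (l'good m).
have at_l y : dotv y e < l -> 0 <= w l y.
  move=> yl; rewrite leNgt; apply/negP => wy.
  have near_l : \forall m \near l, w m y < 0.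
    exact: (cvgr_lt _ (@continuous_reflected_diffl e y l) _ wy).
  move: near_l => /nbhs_ballP[t /= t0 tP].
  (* A level below l, but above y and within t of l. *)
  pose m := Num.max ((dotv y e + l) / 2) (l - t / 2).
  have ml : m < l by rewrite gt_max; apply/andP; split; move: yl t0; lra.
  have ym : dotv y e < m by rewrite lt_max; apply/orP; left; move: yl; lra.
  have : w m y < 0.
    apply: tP; rewrite -ball_normE/= gtr0_norm ?subr_gt0//.
    by rewrite ltrBlDr -ltrBlDl lt_max; apply/orP; right; move: t0; lra.
  by rewrite ltNge below.
have mirror_sym m : (forall y, dotv y e < m -> w m y = 0) -> forall y, u (mirror e m y) = u y.
  move=> w0 y; have [ym|my|ym] := ltgtP (dotv y e) m.
  - by apply/eqP; rewrite -subr_eq0; apply/eqP; exact: w0.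
  - have rm : dotv (mirror e m y) e < m by rewrite dotv_mirror//; move: my; lra.
    by apply/esym/eqP; rewrite -subr_eq0 -{1}(mirrorK e1 m y); apply/eqP; exact: w0.
  - by rewrite mirror_fixed.
have sym : forall y, u (mirror e l y) = u y.
  have [/mirror_sym//|wpos] := reflected_diff_dichotomy e1 at_l.
  (* For levels m below l + d / 2, a negative minimum lies in K, since its
     distance to the hyperplane is at least d. *)
  pose K := [set y : 'rV[R]_N | dotv y e <= l - d / 2 /\ enorm y <= M].
  have /compact_near_coveringP/(_ R (nbhs l) (fun m y => 0 < w m y) _) : compact K.
    exact: compact_halfball.
  move=> near_pos; have /nbhs_ballP : \forall m \near l, K `<=` (fun y => 0 < w m y).
    apply: near_pos => y [yl _]; have wy : 0 < w l y.
      by apply: wpos; apply: le_lt_trans yl _; rewrite ltrBlDr ltrDl divr_gt0.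
    have [[A B] /= [lA yB] AB] := cvgr_gt _ (@continuous_reflected_diff2 e (l, y)) _ wy.
    by exists (B, A) => //= -[y' m] /= [By Am]; exact: (AB (m, y')).
  move=> [t /= t0 tP].
  pose s := Num.min (t / 2) (d / 2); have s0 : 0 < s by rewrite lt_min !divr_gt0.
  suff : good (l + s) by move=> /(sup_upper_bound supgood); rewrite gerDl leNgt s0.
  move=> m ms y ym; rewrite leNgt; apply/negP => wy.
  have lm : l <= m by rewrite leNgt; apply/negP => /below/(_ ym); rewrite leNgt wy.
  have [x [wx xM xd]] := neg_loc _ _ ym wy.
  have : 0 < w m x.
    apply: tP; last first.
      split => //; apply: (le_trans xd); rewrite lerBlDr (le_trans ms)//.
      rewrite -addrA lerD2l; have : s <= d / 2 by rewrite ge_min lexx orbT.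
      lra.
    rewrite -ball_normE/= distrC ger0_norm ?subr_ge0// ltrBlDl (le_lt_trans ms)// ltrD2l.
    by rewrite gt_min; apply/orP; left; rewrite ltr_pdivrMr// ltr_pMr// ltr1n.
  by rewrite ltNge ltW.
exists l; split => // m y ml ym.
have [w0|wpos] := reflected_diff_dichotomy e1 (fun y => below m y ml); last first.
  by rewrite -subr_gt0 wpos.
have := @not_periodic ((2 * (l - m)) *: e); case.
  rewrite scaler_eq0 negb_or mulf_neq0 ?subr_eq0 ?gt_eqF//=.
  by apply: contra_eq_neq e1 => ->; rewrite dotv0l eq_sym oner_eq0.
by move=> x; rewrite -(mirror_comp e1 m l x) sym (mirror_sym m w0 x).
Qed.

End sliding.
End moving_planes.

(** * From planes of symmetry to radial symmetry *)

Section radial_symmetry.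
Variables (R : realType) (N : nat) (u : 'rV[R]_N -> R).
Hypotheses (N0 : (0 < N)%N)
  (aperiodic : forall v, v != 0 -> ~ (forall x, u (x + v) = u x))
  (planes : forall e : 'rV[R]_N, dotv e e = 1 ->
    exists l, (forall y, u (mirror e l y) = u y) /\
      (forall m y, m < l -> dotv y e < m -> u y < u (mirror e m y))).

Lemma unit_neq0 (e : 'rV[R]_N) : dotv e e = 1 -> e != 0.
Proof. by move=> e1; apply: contra_eq_neq e1 => ->; rewrite dotv0l eq_sym oner_eq0. Qed.

(** Two parallel mirrors compose to a translation. *)
Lemma unique_symmetry_plane (e : 'rV[R]_N) (l m : R) : dotv e e = 1 ->
  (forall y, u (mirror e l y) = u y) -> (forall y, u (mirror e m y) = u y) -> l = m.
Proof.
move=> e1 syml symm; apply/eqP; apply: contrapT => /negP lm.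
have := @aperiodic ((2 * (m - l)) *: e); case.
  by rewrite scaler_eq0 negb_or unit_neq0// andbT mulf_neq0// subr_eq0 eq_sym.
by move=> x; rewrite -(mirror_comp e1 l m x) symm syml.
Qed.

Let axis (i : 'I_N) : 'rV[R]_N := delta_mx 0 i.

Let dotv_axis x i : dotv x (axis i) = x 0 i.
Proof.
rewrite /dotv (bigD1 i)//= mxE !eqxx mulr1 big1 ?addr0// => j ji.
by rewrite mxE (negbTE ji) andbF mulr0.
Qed.

Let axis_unit i : dotv (axis i) (axis i) = 1.
Proof. by rewrite dotv_axis mxE !eqxx. Qed.

(** The composition of the mirrors along all the axes, which leave each other's
    coordinates alone. *)
Lemma central_symmetry : exists x0, forall x, u (2 *: x0 - x) = u x.
Proof.
have /choice[c cP] i : exists l, forall y, u (mirror (axis i) l y) = u y.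
  by have [l [lsym _]] := planes (axis_unit i); exists l.
exists (\row_i c i) => x.
(* P s is x after the mirrors along the axes in s. *)
pose P (s : seq 'I_N) : 'rV[R]_N := \row_j (if j \in s then 2 * c j - x 0 j else x 0 j).
have uP s : uniq s -> u (P s) = u x.
  elim: s => [_|i s ih /= /andP[si us]].
    by congr u; apply/rowP => j; rewrite mxE.
  rewrite -(ih us) -(cP i (P s)); congr u; apply/rowP => j.
  rewrite /mirror dotv_axis !mxE (negbTE si) in_cons eqxx /=.
  case: (eqVneq j i) => [->|_]/=; first by rewrite (negbTE si); ring.
  by rewrite mulr0 addr0.
rewrite -(uP (enum 'I_N)) ?enum_uniq//; congr u; apply/rowP => j.
by rewrite !mxE mem_enum.
Qed.

(** Conjugating the mirror at level [l] by the central symmetry gives the mirror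
    at level [2 (x0 . e) - l]. *)
Lemma symmetry_plane_center x0 e : (forall x, u (2 *: x0 - x) = u x) ->
  dotv e e = 1 -> (forall y, u (mirror e (dotv x0 e) y) = u y) /\
      (forall m y, m < dotv x0 e -> dotv y e < m -> u y < u (mirror e m y)).
Proof.
move=> sym0 e1; have [l [syml incr]] := planes e1.
suff <- : l = dotv x0 e by [].
suff : l = 2 * dotv x0 e - l by lra.
apply: (unique_symmetry_plane e1 syml) => y.
rewrite -[RHS]sym0 -[RHS]syml -[RHS]sym0; congr u.
rewrite /mirror !(dotvDl, dotvNl, dotvZl); apply/rowP => i; rewrite !mxE; ring.
Qed.

(** Two points at the same distance from [x0] are mirror images in a hyperplane
    through [x0], orthogonal to their difference. *)
Lemma radially_decreasing : exists x0, radially_decreasing_about u x0.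
Proof.
have [x0 sym0] := central_symmetry; exists x0.
pose e := axis (Ordinal N0).
have e1 : dotv e e = 1 by exact: axis_unit.
have radial x y : enorm (x - x0) = enorm (y - x0) -> u x = u y.
  move=> xy; have [->//|xNy] := eqVneq x y.
  have [d dE] : exists d, d = x - y by exists (x - y).
  pose n := enorm d.
  have n0 : n != 0 by apply: contra_neq xNy => /enorm_eq0; rewrite dE => /subr0_eq.
  have nn : dotv d d = n ^+ 2 by rewrite sqr_enorm.
  pose v := n^-1 *: d.
  have v1 : dotv v v = 1.
    by rewrite dotvZl dotvZr nn expr2 mulKf// mulVf.
  have [symv _] := symmetry_plane_center sym0 v1.
  rewrite -(symv x); congr u.
  have xd : 2 * dotv (x0 - x) d = - n ^+ 2.
    have : dotv (x - x0) (x - x0) = dotv (y - x0) (y - x0) by rewrite -!sqr_enorm xy.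
    have -> : y - x0 = (x - x0) - d by rewrite dE; apply/rowP => i; rewrite !mxE; ring.
    rewrite -(opprB x x0); move: (x - x0) => a.
    rewrite !(dotvDl, dotvDr, dotvNl, dotvNr) nn (dotvC d a); lra.
  have -> : mirror v (dotv x0 v) x = x + (- 1) *: d; last by rewrite scaleN1r dE subKr.
  rewrite /mirror; congr (x + _).
  have -> : dotv x0 v - dotv x v = dotv (x0 - x) d / n by rewrite -dotvNl -dotvDl dotvZr mulrC.
  by rewrite /v scalerA mulrA xd; congr (_ *: d); field.
exists (fun r => u (x0 + r *: e)); split.
  move=> x; apply: radial; rewrite [x0 + _]addrC addrK enormZ (enorm_unit e1) mulr1.
  by rewrite ger0_norm// enorm_ge0.
move=> r s r0 rs.
have [_ incr] := symmetry_plane_center sym0 e1.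
have -> : u (x0 + s *: e) = u (x0 - s *: e).
  by apply: radial; rewrite ![x0 + _]addrC !addrK enormN.
(* The hyperplane halfway between x0 - s e and x0 - r e. *)
pose m := dotv x0 e - (r + s) / 2.
have -> : u (x0 + r *: e) = u (mirror e m (x0 - s *: e)).
  apply: radial; have -> : mirror e m (x0 - s *: e) = x0 - r *: e.
    rewrite /mirror /m !(dotvDl, dotvNl, dotvZl) e1; apply/rowP => i.
    by rewrite !mxE; field.
  by rewrite ![x0 + _]addrC !addrK enormN.
apply: incr; first by rewrite /m; move: (dotv x0 e) => t; lra.
by rewrite /m !(dotvDl, dotvNl, dotvZl) e1; move: (dotv x0 e) => t; lra.
Qed.

End radial_symmetry.

(** * The nonlinearity *)

Section nonlinearity.
Variable R : realType.
Implicit Types a b p q r : R.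

(** Bernoulli's inequality [1 - t^r <= r (1 - t)] for [t = a / b], which is
    Young's inequality for the product [t * 1]. *)
Lemma powR_sub_le r a b : 1 < r -> 0 <= a -> a <= b ->
  b `^ r - a `^ r <= r * b `^ (r - 1) * (b - a).
Proof.
move=> r1 a0 ab; have r0 : 0 < r by exact: lt_trans r1.
have [b0|b0] := leP b 0.
  have -> : b = a by apply/eqP; rewrite eq_le ab (le_trans b0).
  by rewrite !subrr mulr0.
pose t := a / b; have t0 : 0 <= t by rewrite divr_ge0// ltW.
have bernoulli : r * t <= t `^ r + r - 1.
  have r'0 : 0 < r / (r - 1) by rewrite divr_gt0// subr_gt0.
  have := @conjugate_powR R t 1 r (r / (r - 1)) t0 ler01 r0 r'0.
  have r1n0 : r - 1 != 0 by rewrite subr_eq0 gt_eqF.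
  have rn0 : r != 0 by rewrite gt_eqF.
  have -> : r^-1 + (r / (r - 1))^-1 = 1 by field; rewrite r1n0 rn0.
  rewrite mulr1 powR1 => /(_ erefl) young.
  rewrite -(ler_pM2l (x := r^-1)) ?invr_gt0// mulKf//; apply: (le_trans young).
  by rewrite le_eqVlt; apply/orP; left; apply/eqP; field; rewrite r1n0 rn0.
have -> : a = b * t by rewrite /t mulrCA divff ?mulr1// gt_eqF.
rewrite powRM// ?(ltW b0)//.
have -> : r * b `^ (r - 1) * (b - b * t) = b `^ r * (r * (1 - t)).
  by rewrite -[b `^ r](mulr_powRB1 (ltW b0) r0); ring.
rewrite -[X in X - _ <= _]mulr1 -mulrBr ler_wpM2l ?powR_ge0//.
by move: bernoulli; move: (t `^ r) => T; lra.
Qed.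

(** The term [- t^q], which is not Lipschitz at 0, is decreasing and can only
    help. *)
Lemma power_diff_one_sided_lipschitz p q (M : R) : 1 < p -> 0 < q ->
  exists L, forall a b, 0 < a -> a <= b -> b <= M ->
    (b `^ p - b `^ q) - (a `^ p - a `^ q) <= L * (b - a).
Proof.
move=> p1 q0; exists (p * M `^ (p - 1)) => a b a0 ab bM.
have b0 := lt_le_trans a0 ab.
have q_mono : a `^ q <= b `^ q by rewrite ge0_ler_powR ?nnegrE// ltW.
have p_le : b `^ p - a `^ p <= p * b `^ (p - 1) * (b - a) by exact: powR_sub_le (ltW a0) ab.
have : p * b `^ (p - 1) * (b - a) <= p * M `^ (p - 1) * (b - a).
  rewrite ler_wpM2r ?subr_ge0// ler_pM2l ?(lt_trans ltr01)//.
  have M0 := lt_le_trans b0 bM.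
  by rewrite ge0_ler_powR ?nnegrE ?subr_ge0 ?(ltW b0) ?(ltW M0) ?(ltW p1).
move: q_mono p_le; move: (p * _ * _) (p * _ * _) (a `^ q) (b `^ q) (a `^ p) (b `^ p).
by move=> *; lra.
Qed.

(** In terms of [A = a^q] and [B = b^q], the claim is that [B^r - A^r <= B - A]
    with [r = p / q > 1], which holds as long as the slope [r B^(r - 1)] is at
    most 1. *)
Lemma power_diff_nonincreasing_near0 p q : 0 < q -> q < p ->
  exists2 s : R, 0 < s & forall a b, 0 < a -> a <= b -> b <= s ->
    b `^ p - b `^ q <= a `^ p - a `^ q.
Proof.
move=> q0 qp; pose r := p / q; have r1 : 1 < r by rewrite ltr_pdivlMr// mul1r.
have r0 : 0 < r by exact: lt_trans r1.
have pE : p = q * r by rewrite /r mulrCA divff ?mulr1// gt_eqF.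
have qr0 : 0 < q * (r - 1) by rewrite mulr_gt0// subr_gt0.
exists (r^-1 `^ (q * (r - 1))^-1); first by apply: powR_gt0; rewrite invr_gt0.
move=> a b a0 ab bs; have b0 := lt_le_trans a0 ab.
have q_mono : a `^ q <= b `^ q by rewrite ge0_ler_powR ?nnegrE// ltW.
have := powR_sub_le r1 (powR_ge0 a q) q_mono; rewrite -!powRrM -pE.
have rb : r * b `^ (q * (r - 1)) <= 1.
  rewrite -ler_pdivlMl// mulr1.
  have -> : r^-1 = (r^-1 `^ (q * (r - 1))^-1) `^ (q * (r - 1)).
    by rewrite -powRrM mulVf ?gt_eqF// powRr1// invr_ge0 ltW.
  by rewrite ge0_ler_powR ?nnegrE ?powR_ge0// ltW.
have : r * b `^ (q * (r - 1)) * (b `^ q - a `^ q) <= b `^ q - a `^ q.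
  by rewrite ler_piMl// subr_ge0.
by move=> slope /le_trans/(_ slope); rewrite lerBlDr lerBrDr; lra.
Qed.

End nonlinearity.

(** * Radial symmetry of the solutions *)

Theorem theorem4p1 (R : realType) (N : nat) (alpha p q : R)
    (u : 'rV[R]_N -> R) :
  0 < alpha < 1 -> (2 <= N)%N -> 0 < q < 1 -> 1 < p ->
  classical_solution alpha (fun t => t `^ p - t `^ q) u ->
  (forall x, 0 < u x) ->
  u x @[x --> at_infinity] --> 0 ->
  u =O_at_infinity (fun x => enorm x `^ (- ((N%:R + 2 * alpha) / q))) ->
  exists x0 : 'rV[R]_N, radially_decreasing_about u x0.
Proof.
move=> /andP[alpha0 _] N2 /andP[q0 q1] p1 [u_cont u_def u_eq] u_gt0 u_infty _.
have N0 : (0 < N)%N by exact: leq_trans N2.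
apply: radially_decreasing => //.
  by move=> v; exact: not_periodic.
move=> e e1; apply: (moving_planes N0 alpha0 u_cont u_gt0 u_infty u_def u_eq _ _ e1).
  exact: power_diff_nonincreasing_near0 (lt_trans q1 p1).
by move=> M; exact: power_diff_one_sided_lipschitz.
Qed.
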